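(* The toric domain $X_{\Omega_p}$ is a convex toric domain for $p\in[1,2]$, and a concave toric domain for $p\in[2,\infty]$.
   Context: Let $\mu:\mathbb{C}^2\to\mathbb{R}^2$, $\mu(z_1,z_2)=(\pi|z_1|^2,\pi|z_2|^2)$, and for $\Omega\subset\mathbb{R}^2_{\ge0}$ let $X_\Omega=\mu^{-1}(\Omega)$. Suppose $\Omega\subset\mathbb{R}^2_{\ge0}$ is the region bounded by the coordinate axes and the graph of a decreasing continuous function $\phi:[0,a]\to\mathbb{R}_{\ge0}$ with $\phi(a)=0$. Then $X_\Omega$ is called a concave toric domain if $\phi$ is convex, and a convex toric domain if $\phi$ is concave. For $p\in[1,\infty)$ define $g_p:[0,(1/4)^{1/p}]\to\mathbb{R}$ by $$g_p(v)=2\int_{\left(\frac12-\sqrt{\frac14-v^p}\right)^{1/p}}^{\left(\frac12+\sqrt{\frac14-v^p}\right)^{1/p}}\sqrt{(1-r^p)^{2/p}-\frac{v^2}{r^2}}\,dr,$$ and let $\Omega_p$ be the relatively open set in $\mathbb{R}^2_{\ge0}$ bounded by the coordinate axes and the curve parametrized by $(2\pi v+g_p(v),g_p(v))$ for $v\in[0,(1/4)^{1/p}]$ and $(g_p(-v),-2\pi v+g_p(-v))$ for $v\in[-(1/4)^{1/p},0]$. For $p=\infty$, let $\Omega_\infty$ be the relatively open set in $\mathbb{R}^2_{\ge0}$ bounded by the coordinate axes and the curve parametrized by $$2\left(\sqrt{1-v^2}+v(\pi-\arccos v),\ \sqrt{1-v^2}-v\arccos v\right),\quad v\in[-1,1].$$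 *)

(* Defs.v *)
From HB Require Import structures.
From mathcomp Require Import all_boot all_order all_algebra.
From mathcomp Require Import all_classical all_reals all_analysis.
From mathcomp Require Import complex.
Set Implicit Arguments.
Unset Strict Implicit.
Unset Printing Implicit Defensive.
Import Order.TTheory GRing.Theory Num.Theory.
Import numFieldNormedType.Exports.
Local Open Scope classical_set_scope.
Local Open Scope ring_scope.

Definition moment_map (R : realType) (z : R[i] * R[i]) : R * R :=
  (pi * Normc.normc z.1 ^+ 2, pi * Normc.normc z.2 ^+ 2).

Definition toric_domain (R : realType) (Omega : set (R * R)) :
    set (R[i] * R[i]) :=
  @moment_map R @^-1` Omega.

(* The region bounded by the axes and the graph of phi is taken relatively open
   in the quadrant: it contains its edges on the axes, but not the graph. *)
Definition region_under (R : realType) (a : R) (phi : R -> R) : set (R * R) :=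
  [set w | 0 <= w.1 <= a /\ 0 <= w.2 < phi w.1].

(* phi is only meaningful on [0, a]; decreasing is understood strictly. *)
Definition toric_profile (R : realType) (a : R) (phi : R -> R) : Prop :=
  [/\ 0 < a,
      {within `[0, a], continuous phi},
      {in `[0, a] &, forall x y, x < y -> phi y < phi x},
      {in `[0, a], forall x, 0 <= phi x} &
      phi a = 0].

Definition concave_toric_domain (R : realType) (X : set (R[i] * R[i])) : Prop :=
  exists (a : R) (phi : R -> R),
    [/\ toric_profile a phi,
        convex_function (E := R^o) `[0, a] phi &
        X = toric_domain (region_under a phi)].

Definition convex_toric_domain (R : realType) (X : set (R[i] * R[i])) : Prop :=
  exists (a : R) (phi : R -> R),
    [/\ toric_profile a phi,
        convex_function (E := R^o) `[0, a] (fun x => - phi x) &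
        X = toric_domain (region_under a phi)].

Definition quadrant {R : realType} : set (R * R) :=
  [set w | 0 <= w.1 /\ 0 <= w.2].

(* For a curve joining the two axes away from the origin, removing it from the
   quadrant leaves a bounded and an unbounded piece; the region bounded by the
   axes and the curve is the piece containing the origin. *)
Definition region_bounded_by (R : realType) (curve : set (R * R)) :
    set (R * R) :=
  connected_component (quadrant `\` curve) (0, 0).

Definition vmax (R : realType) (p : R) : R := 4^-1 `^ p^-1.

Definition gp (R : realType) (p v : R) : R :=
  2 * \int[lebesgue_measure]_(r in
        `[(2^-1 - Num.sqrt (4^-1 - v `^ p)) `^ p^-1,
          (2^-1 + Num.sqrt (4^-1 - v `^ p)) `^ p^-1])
      Num.sqrt ((1 - r `^ p) `^ (2 / p) - v ^+ 2 / r ^+ 2).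

Definition curve_fin (R : realType) (p : R) : set (R * R) :=
  [set (2 * pi * v + gp p v, gp p v) | v in `[0, vmax p]] `|`
  [set (gp p (- v), - (2 * pi * v) + gp p (- v)) | v in `[- vmax p, 0]].

Definition curve_infty {R : realType} : set (R * R) :=
  [set (2 * (Num.sqrt (1 - v ^+ 2) + v * (pi - acos v)),
        2 * (Num.sqrt (1 - v ^+ 2) - v * acos v)) | v in `[-1, 1]].

(* Only 1 <= p <= +oo is meaningful; the value at -oo is arbitrary. *)
Definition Omega (R : realType) (p : \bar R) : set (R * R) :=
  match p with
  | EFin r => region_bounded_by (curve_fin r)
  | EPInf => region_bounded_by curve_infty
  | ENInf => set0
  end.

(* Main.v *)
Require Import Defs.
From mathcomp Require Import all_boot all_order all_algebra.
From mathcomp Require Import all_classical all_reals all_analysis.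
From mathcomp Require Import measurable_realfun ring lra.
Set Implicit Arguments.
Unset Strict Implicit.
Unset Printing Implicit Defensive.
Import Order.TTheory GRing.Theory Num.Theory.
Import numFieldNormedType.Exports.
Local Open Scope classical_set_scope.
Local Open Scope ring_scope.

(** Why the theorem is true.

    In the coordinates x - y and x + y, the curve bounding Omega_p is the graph
    over [-a, a] of one even function E.  For finite p,
      E u = |u| + 2 g_p (|u| / (2 pi)),  a = 2 pi vmax p,
    and for p = +oo, E (2 pi v) = 4 (sqrt (1 - v^2) + v asin v), a = 2 pi.
    If E (a) = E (-a) = a and E is a strict contraction, the curve is the graph
    of a decreasing continuous phi on [0, a], Omega_p is the region below it,
    and phi is convex or concave as soon as E is ([rotated_curve_toric]).  For
    p = +oo, the derivative asin of v |-> sqrt (1 - v^2) + v asin v settles the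
    matter ([curve_infty_concave]).

    For finite p, put m = vmax p.  What is needed of g_p on [0, m]
    ([action_curve_toric]) is that its slopes lie in ]-2 pi, 0[, and that it is
    convex with slopes at least -pi when p >= 2, concave with slopes at most
    -pi when p <= 2.  For p = 2, the ball, g_2 (v) = pi (m - v) is affine, and
    the other exponents are compared with this one.  The substitution
    x = 1/2 - r^p and the symmetry x |-> -x give, with S_v the square root of
    (1/4 - x^2)^(2/p) - v^2 (taken as 0 when this is negative),
      g_p (v) = int S_v(x) (2/p) / (1/4 - x^2) dx   ([gp_action_density]).
    The change of variable that takes the exponent p to the exponent 2 yields a
    weight W; dividing the density of this integral by W gives a density rho
    with
      int S_v rho = pi (m - v)   ([ball_weight_integral]),
      g_p (v) = int S_v W rho.
    Here W^2 is a chord slope of a power function, so W goes monotonically from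
    sqrt (2/p) at x = 0 to 1 at x = 1/2 ([chord_slope_monotone]).

    Since S_v decreases with v, bounds on W are bounds on the slopes of g_p
    divided by -pi.  For the convexity, take u between v and w, say
    u = t v + (1 - t) w.  As a function of x, the second difference
    N = t S_v + (1 - t) S_w - S_u changes sign once ([sqrt_crossing]), and
    int N rho = 0.  Hence int N W rho = int N (W - W(o)) rho, where o is the
    place of the change of sign, and the last integrand has a constant sign
    because W is monotone.  This argument takes v > 0; the value v = 0 is
    reached by continuity ([gp_near0]). *)

(** * Regions below a graph in rotated coordinates *)

Definition convex_on (R : realType) (D : set R) (f : R -> R) : Prop :=
  forall t x y, 0 <= t <= 1 -> D x -> D y ->
    f (t * x + (1 - t) * y) <= t * f x + (1 - t) * f y.

Section RotatedGraph.
Context (R : realType) (a : R) (E : R -> R).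
Hypothesis a_gt0 : 0 < a.
Hypothesis E_contr : forall u v, u < v -> `|E v - E u| < v - u.
Hypothesis E_out : forall u, a <= `|u| -> E u = a.

(** The curve is the zero set of [gap].  Because E is a strict contraction, [gap]
    is strictly increasing in each coordinate, which makes the curve a graph
    over either axis. *)
Let gap (w : R * R) : R := w.1 + w.2 - E (w.1 - w.2).

Let gap_lt1 x x' y : x < x' -> gap (x, y) < gap (x', y).
Proof.
move=> xx'; rewrite /gap/=.
have /E_contr : x - y < x' - y by lra.
by rewrite ltr_norml => /andP[_]; lra.
Qed.

Let gap_lt2 x y y' : y < y' -> gap (x, y) < gap (x, y').
Proof.
move=> yy'; rewrite /gap/=.
have /E_contr : x - y' < x - y by lra.
by rewrite ltr_norml => /andP[+ _]; lra.
Qed.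

Let gap_le1 x x' y : x <= x' -> gap (x, y) <= gap (x', y).
Proof. by rewrite le_eqVlt => /predU1P[->//|/gap_lt1 /ltW]. Qed.

Let gap_le2 x y y' : y <= y' -> gap (x, y) <= gap (x, y').
Proof. by rewrite le_eqVlt => /predU1P[->//|/gap_lt2 /ltW]. Qed.

Let E_contr_le u v : `|E v - E u| <= `|v - u|.
Proof.
have [uv|vu|->] := ltgtP u v; last by rewrite !subrr.
- by rewrite (gtr0_norm (_ : 0 < v - u)) ?subr_gt0// ltW// E_contr.
- by rewrite distrC (distrC v) (gtr0_norm (_ : 0 < u - v)) ?subr_gt0// ltW// E_contr.
Qed.

Let E_continuous : continuous E.
Proof.
move=> u; apply/cvgrPdist_lt => e e0; near=> v.
apply: le_lt_trans (E_contr_le _ _) _.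
by near: v; exact: (@cvgrPdist_lt _ _ _ (nbhs u) _ id u).1.
Unshelve. all: by end_near. Qed.

Let gap_continuous : continuous gap.
Proof.
move=> w; rewrite /gap.
have c1 : v.1 @[v --> w] --> w.1 by exact: cvg_fst.
have c2 : v.2 @[v --> w] --> w.2 by exact: cvg_snd.
apply: cvgB; first exact: cvgD.
apply: (@continuous_comp _ _ _ (fun v : R * R => v.1 - v.2) E).
  exact: (cvgB c1 c2).
exact: E_continuous.
Qed.

Let gap_continuous1 y : continuous (fun x => gap (x, y)).
Proof.
move=> x; rewrite /gap/=; apply: cvgB.
  by apply: cvgD; [exact: cvg_id|exact: cvg_cst].
apply: (@continuous_comp _ _ _ (fun x => x - y) E); last exact: E_continuous.
by apply: cvgB; [exact: cvg_id|exact: cvg_cst].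
Qed.

Let gap_continuous2 x : continuous (fun y => gap (x, y)).
Proof.
move=> y; rewrite /gap/=; apply: cvgB.
  by apply: cvgD; [exact: cvg_cst|exact: cvg_id].
apply: (@continuous_comp _ _ _ (fun y => x - y) E); last exact: E_continuous.
by apply: cvgB; [exact: cvg_cst|exact: cvg_id].
Qed.

Let Ea : E a = a. Proof. by rewrite E_out// ger0_norm// ltW. Qed.
Let ENa : E (- a) = a. Proof. by rewrite E_out// normrN ger0_norm// ltW. Qed.

Let E_ge u : - a <= u <= a -> `|u| <= E u.
Proof.
move=> /andP[ua ub].
have := E_contr_le u a; have := E_contr_le (- a) u; rewrite Ea ENa.
rewrite (ger0_norm (_ : 0 <= a - u)); last lra.
rewrite (ger0_norm (_ : 0 <= u - - a)); last lra.
by rewrite !ler_norml => /andP[? ?] /andP[? ?]; apply/andP; split; lra.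
Qed.

Let gap0_root x : 0 <= x <= a -> exists2 y, 0 <= y <= a & gap (x, y) = 0.
Proof.
move=> /andP[x0 xa].
have : Num.min (gap (x, 0)) (gap (x, a)) <= 0 <= Num.max (gap (x, 0)) (gap (x, a)).
  rewrite ge_min le_max /gap/= subr0 addr0; apply/andP; split; apply/orP.
    left; have /E_ge : - a <= x <= a by apply/andP; split; lra.
    by rewrite ger0_norm//; lra.
  right; have := E_contr_le (- a) (x - a).
  rewrite ENa (_ : x - a - - a = x); last lra.
  by rewrite (ger0_norm x0) ler_norml => /andP[_]; lra.
move=> /(@IVT R (fun y => gap (x, y)) 0 a 0 (ltW a_gt0)) [|y].
  by apply: continuous_subspaceT; exact: gap_continuous2.
by rewrite in_itv/= => ? ?; exists y.
Qed.

Let gap0_root1 y : 0 <= y <= a -> exists2 x, 0 <= x <= a & gap (x, y) = 0.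
Proof.
move=> /andP[y0 ya].
have : Num.min (gap (0, y)) (gap (a, y)) <= 0 <= Num.max (gap (0, y)) (gap (a, y)).
  rewrite ge_min le_max /gap/= sub0r add0r; apply/andP; split; apply/orP.
    left; have /E_ge : - a <= - y <= a by apply/andP; split; lra.
    by rewrite normrN ger0_norm//; lra.
  right; have := E_contr_le a (a - y).
  rewrite Ea (_ : a - y - a = - y); last lra.
  by rewrite normrN (ger0_norm y0) ler_norml => /andP[_]; lra.
move=> /(@IVT R (fun x => gap (x, y)) 0 a 0 (ltW a_gt0)) [|x].
  by apply: continuous_subspaceT; exact: gap_continuous1.
by rewrite in_itv/= => ? ?; exists x.
Qed.

Definition rotated_profile (x : R) : R := xget 0 [set y | gap (x, y) = 0].
Let phi := rotated_profile.

Let gap_inj2 x y y' : gap (x, y) = gap (x, y') -> y = y'.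
Proof.
move=> h; have [/(gap_lt2 x)|/(gap_lt2 x)|//] := ltgtP y y';
by rewrite h ltxx.
Qed.

Let gap_phi x : 0 <= x <= a -> gap (x, phi x) = 0.
Proof.
move=> /gap0_root[y _ gy]; rewrite /phi /rotated_profile.
by case: xgetP => [y' ->//|/(_ y)/(_ gy)].
Qed.

Let phi_uniq x y : 0 <= x <= a -> gap (x, y) = 0 -> phi x = y.
Proof. by move=> /gap_phi h g; apply: (@gap_inj2 x); rewrite h g. Qed.

Let phi_itv x : 0 <= x <= a -> 0 <= phi x <= a.
Proof. by move=> xa; have [y ya /(phi_uniq xa) ->] := gap0_root xa. Qed.

Let phi_le x y : 0 <= x <= a -> (phi x <= y) = (0 <= gap (x, y)).
Proof.
move=> /gap_phi h; apply/idP/idP => [/(gap_le2 x)|]; first by rewrite h.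
by apply: contraTT; rewrite -!ltNge => /(gap_lt2 x); rewrite h.
Qed.

Let phi_ge x y : 0 <= x <= a -> (y <= phi x) = (gap (x, y) <= 0).
Proof.
move=> /gap_phi h; apply/idP/idP => [/(gap_le2 x)|]; first by rewrite h.
by apply: contraTT; rewrite -!ltNge => /(gap_lt2 x); rewrite h.
Qed.

Let phi_decr : {in `[0, a] &, forall x y, x < y -> phi y < phi x}.
Proof.
move=> x y; rewrite !in_itv/= => xa ya /(@gap_lt1 _ _ (phi x)).
by rewrite gap_phi// => h; rewrite ltNge phi_ge// -ltNge.
Qed.

(** Continuity comes from monotony and surjectivity onto [0, a]: the profile may
    have an infinite slope where E has slope -1 or 1. *)
Lemma rotated_profileP : toric_profile a rotated_profile.
Proof.
have phia : phi a = 0.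
  apply: phi_uniq; first by rewrite lexx ltW.
  by rewrite /gap/= subr0 addr0 Ea subrr.
have phi0 : phi 0 = a.
  apply: phi_uniq; first by rewrite lexx ltW.
  by rewrite /gap/= sub0r add0r ENa subrr.
split => //; last by move=> x; rewrite in_itv/= => /phi_itv/andP[].
apply: segment_dec_surj_continuous.
  by apply: le_nmono_in => x y xa ya xy; exact: phi_decr.
rewrite -/phi phia phi0 => y /=; rewrite in_itv/= => ya.
have [x xa g] := gap0_root1 ya; exists x; first by rewrite /= in_itv.
exact: phi_uniq.
Qed.

Definition rotated_curve : set (R * R) :=
  [set ((E u + u) / 2, (E u - u) / 2) | u in `[- a, a]].

Let rotated_curveE w : 0 <= w.1 -> 0 <= w.2 -> rotated_curve w <-> gap w = 0.
Proof.
case: w => x y /= x0 y0; split=> [[u /=]|g0].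
  rewrite in_itv/= => ua [<- <-]; rewrite /gap/=.
  by rewrite (_ : _ - _ / 2 = u); lra.
have [ua|] := leP a `|x - y|.
  exists (x - y) => /=; last by move: g0; rewrite /gap/= => ?; congr pair; lra.
  have := g0; rewrite /gap/= E_out// => s; rewrite in_itv/=.
  by apply/andP; split; lra.
rewrite ltr_norml => /andP[? ?]; exists (x - y).
  by rewrite /= in_itv/=; apply/andP; split; lra.
by move: g0; rewrite /gap/= => ?; congr pair; lra.
Qed.

Let gap00 : gap (0, 0) < 0.
Proof.
rewrite /gap/= subrr addr0 sub0r oppr_lt0.
have := E_contr (a_gt0); rewrite Ea ltr_norml => /andP[_]; lra.
Qed.

(** A point below the curve is joined to the origin by a segment along which
    [gap] stays negative; and on a connected set that avoids the curve, [gap]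
    cannot pass from its negative value at the origin to a positive one. *)
Lemma rotated_region :
  region_bounded_by rotated_curve = region_under a rotated_profile.
Proof.
have -> : region_under a rotated_profile = [set w | quadrant w /\ gap w < 0].
  apply/seteqP; split=> -[x y] /=.
    move=> [xa /andP[y0 yphi]]; split; first by split=> //=; case/andP: xa.
    by rewrite ltNge -phi_le// -ltNge.
  move=> [[/= x0 y0] g].
  have xa : 0 <= x <= a.
    rewrite x0 leNgt; apply/negP => /(@gap_lt1 _ _ 0); apply/negP.
    rewrite -leNgt {2}/gap/= subr0 addr0 Ea subrr.
    exact: le_trans (gap_le2 _ y0) (ltW g).
  by split=> //; rewrite y0/= ltNge phi_le// -ltNge.
apply/seteqP; split=> w.
  move=> [B [B0 Bsub Bconn] Bw].
  have [qw _] := Bsub _ Bw; split=> //; rewrite ltNge; apply/negP => gw.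
  have /connected_intervalP/(_ (gap (0,0)) (gap w)) : connected [set gap v | v in B].
    apply: connected_continuous_connected => //.
    by apply: continuous_subspaceT => v; exact: gap_continuous.
  move=> /(_ (ex_intro2 _ _ _ B0 erefl) (ex_intro2 _ _ _ Bw erefl) 0).
  rewrite (ltW gap00) gw => /(_ isT) [v Bv gv0].
  have [[v1 v2]] := Bsub _ Bv; apply.
  by apply/rotated_curveE.
move=> [[w1 w2] gw].
apply: (@connected_component_max _ _ [set (t * w.1, t * w.2) | t in `[0, 1]]).
- by exists 0; rewrite /= ?in_itv/= ?lexx ?ler01// !mul0r.
- move=> _ [t /= + <-]; rewrite in_itv/= => /andP[t0 t1].
  have q1 : 0 <= t * w.1 by exact: mulr_ge0.
  have q2 : 0 <= t * w.2 by exact: mulr_ge0.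
  split=> // /rotated_curveE-/(_ q1 q2) g0.
  have : gap (t * w.1, t * w.2) <= gap w.
    case: w w1 w2 {gw q1 q2 g0} => x y /= x0 y0.
    by apply: le_trans (gap_le1 _ _) (gap_le2 _ _); exact: ler_piMl.
  by rewrite g0 leNgt gw.
- apply: connected_continuous_connected; first exact: segment_connected.
  apply: continuous_subspaceT => t.
  apply: (@cvg_pair _ _ _ (nbhs t) (nbhs (t * w.1)) (nbhs (t * w.2)));
    by apply: cvgM; [exact: cvg_id|exact: cvg_cst].
- exists 1; rewrite /= ?in_itv/= ?lexx ?ler01// !mul1r.
  by case: (w).
Qed.

(** By monotony of [gap], y >= phi x means x + y >= E (x - y): up to a linear
    change of coordinates, phi and E have the same epigraph.  The sign e treats
    convexity and concavity together. *)
Lemma rotated_profile_convex (e : R) : e = 1 \/ e = -1 ->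
  convex_on `[- a, a]%classic (fun u => e * E u) ->
  convex_function (E := R^o) `[0, a] (fun x => e * rotated_profile x).
Proof.
move=> e1 cE t x y; rewrite !inE/= !in_itv/= => xa ya.
rewrite !convRE; set s := t%:inum.
have s01 : 0 <= s <= 1 by rewrite /s; apply/andP.
rewrite -/phi.
suff : forall x y : R, 0 <= x <= a -> 0 <= y <= a ->
    e * phi (s * x + (1 - s) * y) <= s * (e * phi x) + (1 - s) * (e * phi y).
  by move=> /(_ x y xa ya).
move: s s01 => {t x y xa ya} s s01 x y xa ya.
have /andP[px0 pxa] := phi_itv xa; have /andP[py0 pya] := phi_itv ya.
have xu : - a <= x - phi x <= a by apply/andP; split; lra.
have yu : - a <= y - phi y <= a by apply/andP; split; lra.
have zI : 0 <= s * x + (1 - s) * y <= a by apply/andP; split; nra.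
have := cE s (x - phi x) (y - phi y) s01.
rewrite /= !in_itv/= => /(_ xu yu).
set z := s * x + (1 - s) * y in zI *.
have -> : s * (x - phi x) + (1 - s) * (y - phi y) =
  z - (s * phi x + (1 - s) * phi y) by rewrite /z; ring.
move: (gap_phi xa) (gap_phi ya); rewrite /gap/= => gx gy.
have Ex : E (x - phi x) = x + phi x by lra.
have Ey : E (y - phi y) = y + phi y by lra.
rewrite Ex Ey; set c := s * phi x + (1 - s) * phi y => h.
case: e1 h => ->; rewrite ?mul1r ?mulN1r => h.
  rewrite phi_le// /gap/= subr_ge0 (le_trans h)//.
  by rewrite le_eqVlt; apply/orP; left; apply/eqP; rewrite /z /c; ring.
suff : c <= phi z by rewrite /c => ?; lra.
rewrite phi_ge// /gap/= subr_le0 -lerN2 (le_trans h)//.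
by rewrite le_eqVlt; apply/orP; left; apply/eqP; rewrite /z /c; ring.
Qed.
End RotatedGraph.

Section Clamp.
Context (R : realType) (a : R).
Hypothesis a_gt0 : 0 < a.

Definition clamp (u : R) : R := Num.max (- a) (Num.min u a).

Lemma clamp_itv u : - a <= clamp u <= a.
Proof.
rewrite /clamp le_max lexx ge_max ge_min lexx orbT !andbT/=.
by have := a_gt0; lra.
Qed.

Lemma clamp_id u : - a <= u <= a -> clamp u = u.
Proof. by move=> /andP[ua au]; rewrite /clamp (min_idPl au) (max_idPr ua). Qed.

Lemma clamp_out u : a <= `|u| -> clamp u = a \/ clamp u = - a.
Proof.
have := a_gt0 => a0; rewrite ler_normr /clamp => /orP[|] au.
  by left; rewrite (min_idPr au); apply/max_idPr; lra.
right; apply/max_idPl; rewrite ge_min; apply/orP; left; lra.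
Qed.

Lemma clamp_le u v : u <= v -> clamp u <= clamp v <= clamp u + (v - u).
Proof.
have := a_gt0 => a0; move=> uv; rewrite /clamp /Num.max /Num.min.
by do !case: ifPn => /=; rewrite -?leNgt => *; apply/andP; split; lra.
Qed.
End Clamp.

(** Composing E with [clamp] gives it the value a outside [-a, a] and keeps it a
    strict contraction: where [clamp] identifies two points, the values of E
    agree. *)
Lemma rotated_curve_toric (R : realType) (a : R) (E : R -> R) (e : R) : 0 < a ->
    (forall u v, - a <= u -> u < v -> v <= a -> `|E v - E u| < v - u) ->
    E a = a -> E (- a) = a -> e = 1 \/ e = -1 ->
    convex_on `[- a, a]%classic (fun u => e * E u) ->
  exists phi : R -> R, [/\ toric_profile a phi,
    convex_function (E := R^o) `[0, a] (fun x => e * phi x) &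
    region_bounded_by (rotated_curve a E) = region_under a phi].
Proof.
move=> a0 Ec Ea ENa e1 cE.
pose E' := E \o clamp a.
have E'E u : - a <= u <= a -> E' u = E u by move=> ua; rewrite /E'/= clamp_id.
have E'c u v : u < v -> `|E' v - E' u| < v - u.
  move=> uv; have /andP[h1 h2] := clamp_le a0 (ltW uv).
  move: h1; rewrite /E'/= le_eqVlt => /predU1P[->|cuv].
    by rewrite subrr normr0 subr_gt0.
  have /andP[cu _] := clamp_itv a0 u; have /andP[_ cv] := clamp_itv a0 v.
  by apply: lt_le_trans (Ec _ _ cu cuv cv) _; rewrite lerBlDl.
have E'out u : a <= `|u| -> E' u = a.
  by rewrite /E'/= => /(clamp_out a0)[] ->.
have -> : rotated_curve a E = rotated_curve a E'.
  by apply/seteqP; split=> w /= [u ua <-]; exists u => //; move: ua;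
    rewrite /= in_itv/= => /E'E ->.
exists (rotated_profile E'); split.
- exact: rotated_profileP.
- apply: rotated_profile_convex => // t x y t01 /=.
  rewrite !in_itv/= => xa ya; rewrite !E'E//.
    by apply: cE; rewrite //= in_itv.
  by apply/andP; split; nra.
- exact: rotated_region.
Qed.

(** * The curve of Omega_oo *)

Section Infinity.
Context (R : realType).
Implicit Types v w : R.

(** The curve of Omega_oo is the rotated graph of E (2 pi v) = 4 c v, and the
    derivative of c is asin. *)
Let c v := Num.sqrt (1 - v ^+ 2) + v * asin v.

Lemma acos_asin v : -1 <= v <= 1 -> acos v = pi / 2 - asin v.
Proof.
move=> v1; have := asin_geNpi2 v1; have := asin_lepi2 v1 => h1 h2.
rewrite -[RHS](@cosK _ (pi / 2 - asin v)); last first.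
  by rewrite in_itv/=; apply/andP; split; lra.
congr acos.
by rewrite cosB cos_pihalf sin_pihalf mul0r add0r mul1r asinK// in_itv.
Qed.

(** On this interval cos is concave, hence below its tangent at beta. *)
Lemma cos_chord (alpha beta : R) :
  alpha \in `[- (pi / 2), pi / 2] -> beta \in `[- (pi / 2), pi / 2] ->
  cos alpha - cos beta <= sin beta * (beta - alpha).
Proof.
move=> ha hb.
have cosc x y : {within `[x, y], continuous (@cos R)}.
  by apply: continuous_subspaceT; exact: continuous_cos.
have [ab|ba|->] := ltgtP alpha beta; last by rewrite !subrr mulr0.
- have [|x] := MVT ab (fun x _ => is_derive_cos x); first exact: cosc.
  rewrite in_itv/= => /andP[ax xb] h.
  have : sin x <= sin beta.
    rewrite leNgt ltr_sin ?ltNge ?(ltW xb)//.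
    move: ha hb; rewrite !in_itv/= => /andP[? ?] /andP[? ?].
    by apply/andP; split; lra.
  nra.
- have [|x] := MVT ba (fun x _ => is_derive_cos x); first exact: cosc.
  rewrite in_itv/= => /andP[ax xb] h.
  have : sin beta <= sin x.
    rewrite leNgt ltr_sin ?ltNge ?(ltW ax)//.
    move: ha hb; rewrite !in_itv/= => /andP[? ?] /andP[? ?].
    by apply/andP; split; lra.
  nra.
Qed.

(** Read through v = sin alpha and w = sin beta, this is [cos_chord]; supporting
    lines of slope asin v give both convexity and the bounds on the slopes. *)
Let c_support v w : -1 <= v <= 1 -> -1 <= w <= 1 ->
  c v + (w - v) * asin v <= c w.
Proof.
move=> v1 w1; rewrite /c -!cos_asin//.
have hv : asin v \in `[- (pi / 2), pi / 2].
  by rewrite in_itv/= asin_geNpi2// asin_lepi2.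
have hw : asin w \in `[- (pi / 2), pi / 2].
  by rewrite in_itv/= asin_geNpi2// asin_lepi2.
have := cos_chord hv hw; rewrite asinK; first nra.
by rewrite in_itv.
Qed.

Let c_contr v w : -1 <= v -> v < w -> w <= 1 ->
  `|c w - c v| < pi / 2 * (w - v).
Proof.
(* |asin| reaches pi / 2 at the end points, but not at the midpoint. *)
move=> v1 vw w1; pose m := (v + w) / 2.
have vm : v < m by rewrite /m; lra.
have mw : m < w by rewrite /m; lra.
have hm : -1 < m < 1 by apply/andP; split; lra.
have hv : -1 <= v <= 1 by apply/andP; split; lra.
have hw : -1 <= w <= 1 by apply/andP; split; lra.
have hm' : -1 <= m <= 1 by apply/andP; split; lra.
have := c_support hw hm'; have := c_support hm' hv.
have := c_support hv hm'; have := c_support hm' hw.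
have := asin_geNpi2 hv; have := asin_lepi2 hw.
have : asin m < pi / 2 by apply: asin_ltpi2; apply/andP; split; lra.
have : - (pi / 2) < asin m by apply: asin_gtNpi2; apply/andP; split; lra.
by rewrite ltr_norml; move=> *; apply/andP; split; nra.
Qed.

Lemma curve_infty_concave : exists (a : R) (phi : R -> R), [/\ toric_profile a phi,
    convex_function (E := R^o) `[0, a] phi &
    region_bounded_by curve_infty = region_under a phi].
Proof.
have pi0 := @pi_gt0 R.
have asin1 : asin (1 : R) = pi / 2.
  by rewrite -[RHS]sinK ?sin_pihalf// in_itv/=; apply/andP; split; lra.
have asinN1 : asin (-1 : R) = - (pi / 2).
  rewrite -[RHS]sinK ?sinN ?sin_pihalf// in_itv/=; apply/andP; split; lra.
pose E (u : R) := 4 * c (u / (2 * pi)).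
have scale (u : R) : - (2 * pi) <= u <= 2 * pi -> -1 <= u / (2 * pi) <= 1.
  have pi20 : 0 < 2 * pi :> R by lra.
  move=> /andP[? ?]; apply/andP; split.
    by rewrite (ler_pdivlMr _ _ pi20); lra.
  by rewrite (ler_pdivrMr _ _ pi20); lra.
have pi2 : (2 * pi : R) != 0 by lra.
have := @rotated_curve_toric R (2 * pi) E 1; case.
- lra.
- move=> u v ua uv va; rewrite /E -mulrBr normrM ger0_norm//.
  have := @c_contr (u / (2 * pi)) (v / (2 * pi)).
  rewrite ltr_pM2r ?invr_gt0; last lra.
  have /andP[-> _] := scale u ltac:(apply/andP; split; lra).
  have /andP[_ ->] := scale v ltac:(apply/andP; split; lra).
  move=> /(_ isT uv isT) h.
  apply: (@lt_le_trans _ _ (4 * (pi / 2 * (v / (2 * pi) - u / (2 * pi))))).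
    by rewrite ltr_pM2l.
  by rewrite le_eqVlt; apply/orP; left; apply/eqP; field; lra.
- rewrite /E /c divff// expr1n subrr sqrtr0 add0r mul1r asin1; lra.
- rewrite /E /c mulNr divff// sqrrN expr1n subrr sqrtr0 add0r asinN1; lra.
- by left.
- move=> t x y /andP[t0 t1]; rewrite /= !in_itv/= => xa ya.
  rewrite !mul1r /E.
  have za : - (2 * pi) <= t * x + (1 - t) * y <= 2 * pi by apply/andP; split; nra.
  have hx := c_support (scale _ za) (scale _ xa).
  have hy := c_support (scale _ za) (scale _ ya).
  move: hx hy; rewrite (mulrDl (t * x)) -(mulrA t) -(mulrA (1 - t)).
  set Z := asin _; set X := x / _; set Y := y / _; set C := c _ => hx hy.
  have := ler_wpM2l t0 hx.
  have t1' : 0 <= 1 - t by lra.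
  by have := ler_wpM2l t1' hy; lra.
move=> phi [tp cp rp]; exists (2 * pi), phi; split=> //.
  by move: cp; rewrite (_ : (fun x => 1 * phi x) = phi)//; apply/funext => x; rewrite mul1r.
rewrite -rp; congr region_bounded_by; apply/seteqP; split=> -[w1 w2] /= [].
  move=> v v1 [<- <-]; exists (2 * pi * v); first by
    move: v1; rewrite /= !in_itv/= => /andP[? ?]; apply/andP; split; nra.
  rewrite /E (_ : 2 * pi * v / (2 * pi) = v); last by field; lra.
  by rewrite acos_asin /c; [congr pair; lra|move: v1; rewrite /= in_itv].
move=> u; rewrite /= in_itv/= => /scale u1 [<- <-].
exists (u / (2 * pi)); first by rewrite /= in_itv.
rewrite acos_asin// /E; set v := u / _.
have -> : u = 2 * pi * v by rewrite /v; field; lra.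
by rewrite /c; congr pair; lra.
Qed.
End Infinity.

(** * From an action function to its curve *)

(** The curve is the rotated graph of E u = |u| + 2 g (|u| / (2 pi)).  Slopes of
    g in ]-2 pi, 0[ make E a strict contraction.  The convexity of g passes to
    the even function E if E is nondecreasing on [0, a], that is, if the slopes
    of g are at least -pi; concavity requires the reverse. *)
Lemma action_curve_toric (R : realType) (m : R) (g : R -> R) (e : R) :
    0 < m -> g m = 0 -> e = 1 \/ e = -1 ->
    (forall v w, 0 <= v -> v < w -> w <= m -> 0 < g v - g w < 2 * pi * (w - v)) ->
    (forall v w, 0 <= v -> v < w -> w <= m -> e * (g v - g w) <= e * (pi * (w - v))) ->
    convex_on `[0, m]%classic (fun v => e * g v) ->
  exists (a : R) (phi : R -> R), [/\ toric_profile a phi,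
    convex_function (E := R^o) `[0, a] (fun x => e * phi x) &
    region_bounded_by
      ([set (2 * pi * v + g v, g v) | v in `[0, m]] `|`
       [set (g (- v), - (2 * pi * v) + g (- v)) | v in `[- m, 0]])
    = region_under a phi].
Proof.
move=> m0 gm e1 gd ge gc.
have pi0 := @pi_gt0 R.
pose c := (2 * pi)^-1 : R.
have c0 : 0 < c by rewrite invr_gt0; lra.
have pic : 2 * pi * c = 1 by rewrite /c mulfV//; lra.
pose a := 2 * pi * m.
have a0 : 0 < a by rewrite /a; nra.
have ca : c * a = m by rewrite /a /c mulKf//; lra.
pose f x := x + 2 * g (c * x).
have fc x y : 0 <= x -> x < y -> y <= a -> `|f y - f x| < y - x.
  move=> x0 xy ya.
  have /andP[] : 0 < g (c * x) - g (c * y) < 2 * pi * (c * y - c * x).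
    by apply: gd; [nra|rewrite ltr_pM2l|rewrite -ca ler_pM2l].
  rewrite -mulrBr mulrA pic mul1r => h1 h2.
  by rewrite /f ltr_norml; apply/andP; split; lra.
have fe x y : 0 <= x -> x <= y -> y <= a -> e * f x <= e * f y.
  move=> x0; rewrite le_eqVlt => /predU1P[->//|xy] ya.
  have : e * (g (c * x) - g (c * y)) <= e * (pi * (c * y - c * x)).
    by apply: ge; [nra|rewrite ltr_pM2l|rewrite -ca ler_pM2l].
  have -> : pi * (c * y - c * x) = (y - x) / 2.
    by rewrite -mulrBr mulrA (_ : pi * c = 2^-1) 1?mulrC//; lra.
  by rewrite /f => h; lra.
have [phi [tp cp rp]] : exists phi : R -> R, [/\ toric_profile a phi,
    convex_function (E := R^o) `[0, a] (fun x => e * phi x) &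
    region_bounded_by (rotated_curve a (fun u => f `|u|)) = region_under a phi].
  have fa : f a = a by rewrite /f ca gm mulr0 addr0.
  apply: rotated_curve_toric => //.
  - move=> u v ua uv va.
    have hu : `|u| <= a by rewrite ler_norml; apply/andP; split; lra.
    have hv : `|v| <= a by rewrite ler_norml; apply/andP; split; lra.
    have [h|h|->] := ltgtP `|u| `|v|; last by rewrite subrr normr0 subr_gt0.
      apply: lt_le_trans (fc _ _ (normr_ge0 _) h hv) _.
      have := lerB_dist v u; have -> // : `|v - u| = v - u.
      by rewrite ger0_norm// subr_ge0 ltW.
    rewrite distrC; apply: lt_le_trans (fc _ _ (normr_ge0 _) h hu) _.
    have := lerB_dist u v; have -> // : `|u - v| = v - u.
    by rewrite distrC ger0_norm// subr_ge0 ltW.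
  - by rewrite ger0_norm// ltW.
  - by rewrite normrN ger0_norm// ltW.
  - move=> t u v /[dup] t01 /andP[t0 t1]; rewrite /= !in_itv/= => ua va.
    have hu : 0 <= `|u| <= a by rewrite normr_ge0 ler_norml.
    have hv : 0 <= `|v| <= a by rewrite normr_ge0 ler_norml.
    have t1' : 0 <= 1 - t by lra.
    apply: (@le_trans _ _ (e * f (t * `|u| + (1 - t) * `|v|))).
      apply: fe => //.
        apply: (le_trans (ler_normD _ _)).
        by rewrite !normrM (ger0_norm t0) (ger0_norm t1').
      by case/andP: hu => ? ?; case/andP: hv => ? ?; nra.
    have := gc t (c * `|u|) (c * `|v|) t01.
    rewrite /= !in_itv/= -ca => gcc.
    have scale (z : R) : 0 <= `|z| <= a -> 0 <= c * `|z| <= c * a.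
      by move=> /andP[z0 za]; rewrite mulr_ge0 ?(ltW c0)// ler_pM2l.
    have cu := scale _ hu; have cv := scale _ hv.
    move: (gcc cu cv).
    have -> : t * (c * `|u|) + (1 - t) * (c * `|v|) =
        c * (t * `|u| + (1 - t) * `|v|) by ring.
    by rewrite /f; lra.
exists a, phi; split=> //; rewrite -rp; congr region_bounded_by.
apply/seteqP; split=> w /=.
  move=> [] [v /= +] <-; rewrite in_itv/= => /andP[v0 v1].
    exists (2 * pi * v); first by rewrite /= in_itv/= /a; apply/andP; split; nra.
    rewrite ger0_norm; last nra.
    by rewrite /f mulrA (mulrC c) pic mul1r; congr pair; lra.
  exists (2 * pi * v); first by rewrite /= in_itv/= /a; apply/andP; split; nra.
  rewrite ler0_norm; last nra.
  by rewrite /f mulrN mulrA (mulrC c) pic mul1r; congr pair; lra.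
move=> [u /=]; rewrite in_itv/= => /andP[ua ub] <-.
have uE : u = 2 * pi * (c * u) by rewrite mulrA pic mul1r.
have cu1 : c * u <= m by rewrite -ca ler_pM2l.
have cu2 : - m <= c * u by rewrite -ca -mulrN ler_pM2l.
have [u0|u0] := leP 0 u; [left|right].
  exists (c * u); first by rewrite /= in_itv/= cu1 andbT; nra.
  by rewrite -uE ger0_norm// /f; congr pair; lra.
exists (c * u); first by rewrite /= in_itv/= cu2/=; nra.
by rewrite -uE ltr0_norm// /f mulrN; congr pair; lra.
Qed.

(** * Chord slopes of power functions *)

Section ChordSlope.
Context (R : realType) (b : R).
Hypothesis b_gt0 : 0 < b.

Lemma powR_continuous (a x : R) : 0 < x -> {for x, continuous (@powR R ^~ a)}.
Proof.
move=> x0; apply/differentiable_continuous/derivable1_diffP.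
by have [] := is_derive1_powR a x0.
Qed.

Lemma powR_MVT (x y : R) : 0 < x -> x < y ->
  exists2 z, x < z < y & y `^ b - x `^ b = b * z `^ (b - 1) * (y - x).
Proof.
move=> x0 xy.
have [z|z|z] := @MVT R (@powR R ^~ b) (fun z => b * z `^ (b - 1)) x y xy.
- rewrite in_itv/= => /andP[xz _]; apply: is_derive1_powR; exact: lt_trans xz.
- apply: derivable_within_continuous => u; rewrite in_itv/= => /andP[xu _].
  by have [] := is_derive1_powR b (lt_le_trans x0 xu).
- by rewrite in_itv/= => h ->; exists z.
Qed.

(** Slope of the chord of z |-> z^b over [1 - x, 1], extended to x = 0 by the
    derivative at 1. *)
Definition chord_slope (x : R) : R :=
  if x == 0 then b else (1 - (1 - x) `^ b) / x.

Lemma chord_slopeE x : x * chord_slope x = 1 - (1 - x) `^ b.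
Proof.
rewrite /chord_slope; have [->|x0] := eqVneq x 0.
  by rewrite mul0r subr0 powR1 subrr.
by rewrite mulrC divfK.
Qed.

Lemma chord_slope_continuous x : x < 1 -> {for x, continuous chord_slope}.
Proof.
move=> x1.
have cf (u : R) : u < 1 -> {for u, continuous (fun u : R => (1 - u) `^ b)}.
  move=> u1; apply: (@continuous_comp _ _ _ (fun u : R => 1 - u) (@powR R ^~ b)).
    by apply: cvgB; [exact: cvg_cst|exact: cvg_id].
  by apply: powR_continuous; rewrite subr_gt0.
have [x0|x0] := eqVneq x 0; last first.
  have : (fun u : R => (1 - (1 - u) `^ b) / u) u @[u --> x] --> chord_slope x.
    rewrite /chord_slope (negbTE x0); apply: cvgM.
      by apply: cvgB; [exact: cvg_cst|exact: cf].
    by apply: cvgV => //; exact: cvg_id.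
  apply: cvg_trans; apply: near_eq_cvg; near=> u.
  rewrite /chord_slope ifF//; apply/negbTE.
  by near: u; apply: (@cvgr_neq0 _ _ _ (nbhs x) _ id x) => //; exact: cvg_id.
rewrite {x}x0 in x1 *; rewrite /chord_slope.
have dpow : is_derive (1 - 0 : R) 1 (@powR R ^~ b) (b * (1 - 0) `^ (b - 1)).
  by apply: is_derive1_powR; rewrite subr0.
have dlin : is_derive (0 : R) 1 (fun u : R => 1 - u) (-1).
  rewrite -[X in is_derive _ _ _ X]sub0r.
  exact: (is_deriveB (is_derive_cst (1 : R) _ _) (is_derive_id _ _)).
have := @is_derive1_comp _ (@powR R ^~ b) (fun u : R => 1 - u) 0 _ _ dpow dlin.
rewrite subr0 powR1 mulr1 mulrN1 => -[/= dF DF].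
apply/continuous_withinNx; rewrite eqxx.
have : - (h^-1 *: (((@powR R ^~ b \o (fun u : R => 1 - u)) \o shift 0) (h *: 1)
    - (@powR R ^~ b \o (fun u : R => 1 - u)) 0)) @[h --> 0^'] --> b.
  by rewrite -[X in _ --> X]opprK -DF; apply: cvgN; exact: dF.
apply: cvg_trans; apply: near_eq_cvg; near=> u.
have u0 : u != 0 by near: u; exact: nbhs_dnbhs_neq.
rewrite (negbTE u0) /= addr0 subr0 powR1 [u *: 1]mulr1.
by rewrite -scalerN opprB [_ *: _]mulrC.
Unshelve. all: by end_near. Qed.

(** The bound b is the mean value theorem; the bound 1 compares (1 - x)^b with
    1 - x. *)
Lemma chord_slope_bounds x : 0 <= x < 1 ->
  (1 <= b -> 1 <= chord_slope x <= b) /\ (b <= 1 -> b <= chord_slope x <= 1).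
Proof.
move=> /andP[]; rewrite le_eqVlt => /predU1P[<- _|x0 x1].
  by rewrite /chord_slope eqxx !lexx; split => // ->.
have y0 : 0 < 1 - x by rewrite subr_gt0.
have y1 : 1 - x < 1 by rewrite gtrBl.
have [z /andP[z0 z1]] := powR_MVT y0 y1.
have {}z0 := lt_trans y0 z0.
rewrite powR1 subKr -chord_slopeE mulrC => /(mulIf (lt0r_neq0 x0)) E.
split=> b1; apply/andP; split.
- rewrite -(ler_pM2l x0) chord_slopeE mulr1.
  have : (1 - x) `^ b <= 1 - x by apply: ge1r_powR; rewrite // y0 ltW.
  lra.
- rewrite E -[leRHS]mulr1 ler_pM2l//.
  suff : z `^ (b - 1) <= 1 `^ (b - 1) by rewrite powR1.
  apply: ge0_ler_powR; rewrite ?nnegrE ?subr_ge0 ?ler01 ?(ltW z0) ?(ltW z1)//.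
- rewrite E -[leLHS]mulr1 ler_pM2l//.
  suff : z `^ 0 <= z `^ (b - 1) by rewrite powRr0.
  by apply: ger_powR; rewrite ?z0 ?subr_le0// ltW.
- rewrite -(ler_pM2l x0) chord_slopeE mulr1.
  have : 1 - x <= (1 - x) `^ b by apply: ger1_powR; rewrite // y0 ltW.
  lra.
Qed.

(** The slope over [1 - y, 1] is a weighted mean of the slopes over [1 - y, 1 - x]
    and [1 - x, 1]; by the mean value theorem these are values of b z^(b - 1) on
    either side of 1 - x. *)
Lemma chord_slope_monotone x y : 0 <= x -> x <= y -> y < 1 ->
  (1 <= b -> chord_slope y <= chord_slope x) /\
  (b <= 1 -> chord_slope x <= chord_slope y).
Proof.
move=> x0; rewrite le_eqVlt => /predU1P[->|xy] y1; first by rewrite !lexx.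
have y0 : 0 < y by exact: le_lt_trans xy.
have [x0'|xpos] : x = 0 \/ 0 < x.
  by move: x0; rewrite le_eqVlt => /predU1P[<-|]; [left|right].
  have /chord_slope_bounds[h1 h2] : 0 <= y < 1 by rewrite (ltW y0).
  rewrite {2 3}/chord_slope x0' eqxx; split=> [/h1|/h2] /andP[//].
have hy0 : 0 < 1 - y by rewrite subr_gt0.
have hyx : 1 - y < 1 - x by lra.
have hx1 : 1 - x < 1 by lra.
have [z /andP[z0 z1]] := powR_MVT hy0 hyx.
have [w /andP[w0 w1]] := powR_MVT (lt_trans hy0 hyx) hx1.
have {}z0 := lt_trans hy0 z0.
have zw := lt_trans z1 w0.
rewrite powR1 subKr -chord_slopeE mulrC => /(mulIf (lt0r_neq0 xpos)) Ex.
have -> : (1 - x) `^ b - (1 - y) `^ b = y * chord_slope y - x * chord_slope x.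
  by rewrite !chord_slopeE; lra.
move=> Ey.
have slope u v : u <= v -> 
  y * chord_slope y - x * chord_slope x = u * (y - x) -> chord_slope x = v ->
  chord_slope y <= chord_slope x.
  by move=> uv E1 E2; rewrite -(ler_pM2l y0) E2; nra.
have slope' u v : v <= u -> 
  y * chord_slope y - x * chord_slope x = u * (y - x) -> chord_slope x = v ->
  chord_slope x <= chord_slope y.
  by move=> uv E1 E2; rewrite -(ler_pM2l y0) E2; nra.
have Ey' : y * chord_slope y - x * chord_slope x = b * z `^ (b - 1) * (y - x).
  by rewrite Ey; congr (_ * _); lra.
split=> b1.
  apply: (slope _ _ _ Ey' Ex); rewrite ler_pM2l//.
  by apply: ge0_ler_powR; rewrite ?nnegrE ?subr_ge0 ?(ltW z0) ?(ltW zw) ?(ltW (lt_trans z0 zw)).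
apply: (slope' _ _ _ Ey' Ex); rewrite ler_pM2l//.
rewrite -[b - 1]opprK (powRN w) (powRN z) lef_pV2 ?posrE ?powR_gt0 ?(lt_trans z0 zw)//.
by apply: ge0_ler_powR; rewrite ?nnegrE ?oppr_ge0 ?subr_le0 ?(ltW z0) ?(ltW zw) ?(ltW (lt_trans z0 zw)).
Qed.
End ChordSlope.

(** * Integrals of functions continuous on ]-1/2, 1/2[ *)

Lemma sqr_continuous (R : realType) : continuous (fun x : R => x ^+ 2).
Proof.
move=> x; have c2 : (fun u : R => u * u) u @[u --> x] --> x * x.
  by apply: cvgM; exact: cvg_id.
exact: c2.
Qed.

Lemma sqrt_1Bsqr_continuous (R : realType) :
  continuous (fun x : R => Num.sqrt (1 - x ^+ 2)).
Proof.
move=> x; apply: (@continuous_comp _ _ _ (fun x : R => 1 - x ^+ 2) Num.sqrt).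
  by apply: cvgB; [exact: cvg_cst|exact: sqr_continuous].
exact: sqrt_continuous.
Qed.

Section HalfInterval.
Context (R : realType).

(** In the variable x = 1/2 - r^p all integrands are continuous on
    ]-1/2, 1/2[, and some are singular at its ends. *)
Definition cont_half (f : R -> R) : Prop :=
  forall x, -2^-1 < x < 2^-1 -> {for x, continuous f}.

Lemma cont_half_within f a b : -2^-1 < a -> b < 2^-1 -> cont_half f ->
  {within `[a, b], continuous f}.
Proof.
move=> a1 b1 cf; apply: continuous_in_subspaceT => x.
rewrite inE/= in_itv/= => /andP[ax xb]; apply: cf.
by rewrite (lt_le_trans a1 ax) (le_lt_trans xb b1).
Qed.

Lemma cont_half_integrable f a b : -2^-1 < a -> b < 2^-1 -> cont_half f ->
  lebesgue_measure.-integrable `[a, b] (EFin \o f).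
Proof.
move=> a1 b1 cf; apply: continuous_compact_integrable; first exact: segment_compact.
exact: cont_half_within.
Qed.

Lemma cont_halfD f g : cont_half f -> cont_half g -> cont_half (fun x => f x + g x).
Proof. by move=> cf cg x x1; apply: cvgD; [exact: cf|exact: cg]. Qed.

Lemma cont_halfN f : cont_half f -> cont_half (fun x => - f x).
Proof. by move=> cf x x1; apply: cvgN; exact: cf. Qed.

Lemma cont_halfM f g : cont_half f -> cont_half g -> cont_half (fun x => f x * g x).
Proof. by move=> cf cg x x1; apply: cvgM; [exact: cf|exact: cg]. Qed.

Lemma cont_halfV f : (forall x, -2^-1 < x < 2^-1 -> f x != 0) ->
  cont_half f -> cont_half (fun x => (f x)^-1).
Proof. by move=> f0 cf x x1; apply: cvgV; [exact: f0|exact: cf]. Qed.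

Lemma cont_half_cst (c : R) : cont_half (fun=> c).
Proof. by move=> x _; exact: cvg_cst. Qed.

Lemma cont_half_sqrt f : cont_half f -> cont_half (fun x => Num.sqrt (f x)).
Proof.
by move=> cf x x1; apply: continuous_comp; [exact: cf|exact: sqrt_continuous].
Qed.

Lemma cont_half_powR (r : R) f : (forall x, -2^-1 < x < 2^-1 -> 0 < f x) ->
  cont_half f -> cont_half (fun x => f x `^ r).
Proof.
move=> f0 cf x x1; apply: (@continuous_comp _ _ _ f (@powR R ^~ r)); first exact: cf.
exact/powR_continuous/f0.
Qed.

Lemma cont_half_sqr : cont_half (fun x => x ^+ 2).
Proof. by move=> x _; exact: sqr_continuous. Qed.

Lemma cont_half_opp f : cont_half f -> cont_half (fun x => f (- x)).
Proof.
move=> cf x /andP[x1 x2]; apply: continuous_comp; first exact: opp_continuous.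
by apply: cf; apply/andP; split; lra.
Qed.

Lemma Rintegral_symm (f : R -> R) s : 0 <= s < 2^-1 -> cont_half f ->
  \int[lebesgue_measure]_(x in `[- s, s]) f x =
  \int[lebesgue_measure]_(x in `[0, s]) (f x + f (- x)).
Proof.
move=> /andP[s0 s1] cf.
have Ns1 : - 2^-1 < - s by rewrite ltrN2.
have h0 : -2^-1 < 0 :> R by lra.
have h1 : 0 < 2^-1 :> R by lra.
rewrite RintegralD//=; [|exact: cont_half_integrable|]; last first.
  by apply: cont_half_integrable => //; exact: cont_half_opp.
have -> : \int[lebesgue_measure]_(x in `[0, s]) f (- x) =
    \int[lebesgue_measure]_(x in `[- s, 0]) f x.
  rewrite /Rintegral -[X in `[- s, X]]oppr0 integration_by_substitution_oppr//.
  by rewrite oppr0; exact: cont_half_within.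
rewrite -(@Rintegral_itv_obnd_cbnd _ 0 (BRight s)); last first.
  have := @cont_half_integrable f 0 s h0 s1 cf; move=> /integrableS; apply => //.
  by apply: subset_itvr; rewrite bnd_simp.
rewrite -(@Rintegral_itvB _ f (BLeft (- s)) (BRight s) 0) ?bnd_simp//; last 2 first.
- exact: cont_half_integrable.
- by lra.
by rewrite subrK.
Qed.

Lemma le_Rintegral_half (f g : R -> R) s : s < 2^-1 ->
    cont_half f -> cont_half g -> (forall x, 0 <= x <= s -> f x <= g x) ->
  \int[lebesgue_measure]_(x in `[0, s]) f x <=
  \int[lebesgue_measure]_(x in `[0, s]) g x.
Proof.
move=> s1 cf cg fg; have h0 : -2^-1 < 0 :> R by lra.
apply: le_Rintegral => //=.
- exact: cont_half_integrable.
- exact: cont_half_integrable.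
Qed.

Lemma eq_Rintegral_half (f g : R -> R) s :
    (forall x, 0 <= x <= s -> f x = g x) ->
  \int[lebesgue_measure]_(x in `[0, s]) f x =
  \int[lebesgue_measure]_(x in `[0, s]) g x.
Proof.
by move=> fg; apply: eq_Rintegral => x; rewrite inE/= in_itv/=; exact: fg.
Qed.
End HalfInterval.

(** * The action function in a symmetric variable *)

Section Action.
Context (R : realType) (p : R).
Hypothesis p_ge1 : 1 <= p.

Let p_gt0 : 0 < p. Proof. exact: lt_le_trans p_ge1. Qed.

(** The integrand of [gp p v] multiplied by r, in the variable x = 1/2 - r^p, for
    which r^p (1 - r^p) = 1/4 - x^2.  It vanishes from [action_end v] on, since
    the square root of a negative number is 0. *)
Definition action_density (v x : R) : R :=
  Num.sqrt ((4^-1 - x ^+ 2) `^ (2 / p) - v ^+ 2).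

Definition action_end (v : R) : R := Num.sqrt (4^-1 - v `^ p).

Lemma quarter_gt0 (x : R) : -2^-1 < x < 2^-1 -> 0 < 4^-1 - x ^+ 2.
Proof. by move=> /andP[? ?]; nra. Qed.

Lemma ler_powR_mono (r x y : R) : 0 < r -> 0 <= x -> 0 <= y ->
  (x `^ r <= y `^ r) = (x <= y).
Proof.
move=> r0 x0 y0; apply/idP/idP.
  by apply: contraTT; rewrite -!ltNge; apply: gt0_ltr_powR.
by apply: ge0_ler_powR => //; exact: ltW.
Qed.

Lemma powR_p2 (v : R) : 0 <= v -> (v `^ p) `^ (2 / p) = v ^+ 2.
Proof.
by move=> v0; rewrite -powRrM mulrCA divff ?gt_eqF// mulr1 -powR_mulrn.
Qed.

Lemma ler_sqr_powR (v y : R) : 0 <= v -> 0 <= y ->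
  (v ^+ 2 <= y `^ (2 / p)) = (v `^ p <= y).
Proof. by move=> v0 y0; rewrite -powR_p2// ler_powR_mono ?powR_ge0// divr_gt0. Qed.

Lemma vmax_gt0 : 0 < vmax p.
Proof. by rewrite /vmax powR_gt0// invr_gt0. Qed.

Lemma vmax_powR : vmax p `^ p = 4^-1.
Proof. by rewrite /vmax -powRrM mulVf ?gt_eqF// powRr1// invr_ge0. Qed.

Lemma powR_quarter v : 0 <= v <= vmax p -> v `^ p <= 4^-1.
Proof.
move=> /andP[v0 vm]; rewrite -vmax_powR ler_powR_mono//.
exact: ltW vmax_gt0.
Qed.

Lemma le_action_end v x : 0 <= v <= vmax p -> 0 <= x < 2^-1 ->
  (x <= action_end v) = (v ^+ 2 <= (4^-1 - x ^+ 2) `^ (2 / p)).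
Proof.
move=> /[dup] vm /andP[v0 _] /andP[x0 x1].
have q0 : 0 < 4^-1 - x ^+ 2 by apply: quarter_gt0; rewrite x1 andbT; lra.
rewrite ler_sqr_powR// ?(ltW q0)// -[LHS]ler_sqr ?nnegrE ?sqrtr_ge0//.
rewrite sqr_sqrtr ?subr_ge0 ?powR_quarter//.
by apply/idP/idP; lra.
Qed.

Lemma action_end_lt v : 0 < v -> 0 <= action_end v < 2^-1.
Proof.
move=> v0; rewrite sqrtr_ge0/= -[X in _ < X]ger0_norm ?invr_ge0// -sqrtr_sqr.
have := powR_gt0 p v0.
rewrite ltr_sqrt; first nra.
lra.
Qed.

Lemma action_density_cont v : cont_half (action_density v).
Proof.
apply: cont_half_sqrt; apply: cont_halfD; last exact: cont_half_cst.
apply: cont_half_powR; first exact: quarter_gt0.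
apply: cont_halfD; first exact: cont_half_cst.
exact/cont_halfN/cont_half_sqr.
Qed.

Lemma powR_itv01 (r : R) : 0 < r < 1 -> 0 < r `^ p < 1.
Proof.
move=> /andP[r0 r1]; rewrite powR_gt0//=.
suff : r `^ p < 1 `^ p by rewrite powR1.
by apply: gt0_ltr_powR; rewrite ?nnegrE// ltW.
Qed.

Lemma gp_integrand_continuous (v r : R) : 0 < r < 1 -> {for r, continuous
  (fun r => Num.sqrt ((1 - r `^ p) `^ (2 / p) - v ^+ 2 / r ^+ 2))}.
Proof.
move=> r01; have [r0 r1] := andP r01.
apply: (@continuous_comp _ _ _
  (fun r : R => (1 - r `^ p) `^ (2 / p) - v ^+ 2 / r ^+ 2) Num.sqrt); last first.
  exact: sqrt_continuous.
apply: cvgB.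
  apply: (@continuous_comp _ _ _ (fun r : R => 1 - r `^ p) (@powR R ^~ (2 / p))).
    by apply: cvgB; [exact: cvg_cst|exact: powR_continuous].
  by apply: powR_continuous; rewrite subr_gt0; case/andP: (powR_itv01 r01).
apply: cvgM; first exact: cvg_cst.
apply: cvgV; first by rewrite expf_neq0// gt_eqF.
exact: sqr_continuous.
Qed.

Let F (x : R) := (2^-1 - x) `^ p^-1.
Let F' (x : R) := - (p^-1 * (2^-1 - x) `^ (p^-1 - 1)).

Let dF (x : R) : x < 2^-1 -> is_derive x 1 F (F' x).
Proof.
move=> x1.
have d1 : is_derive (2^-1 - x) 1 (@powR R ^~ p^-1) (p^-1 * (2^-1 - x) `^ (p^-1 - 1)).
  by apply: is_derive1_powR; rewrite subr_gt0.
have d2 : is_derive x 1 (fun u : R => 2^-1 - u) (-1).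
  rewrite -[X in is_derive _ _ _ X]sub0r.
  exact: (is_deriveB (is_derive_cst (2^-1 : R) _ _) (is_derive_id _ _)).
have := @is_derive1_comp _ (@powR R ^~ p^-1) (fun u : R => 2^-1 - u) x _ _ d1 d2.
by rewrite mulrN1.
Qed.

Let cF (x : R) : x < 2^-1 -> {for x, continuous F}.
Proof.
move=> x1; apply/differentiable_continuous/derivable1_diffP.
by have [] := dF x1.
Qed.

Let cdF (x : R) : x < 2^-1 -> {for x, continuous F^`()%classic}.
Proof.
move=> x1; have E y : y < 2^-1 -> F^`()%classic y = F' y.
  by move=> y1; rewrite derive1E; have [] := dF y1.
have : F' u @[u --> x] --> F^`()%classic x.
  rewrite E//; apply: cvgN; apply: cvgM; first exact: cvg_cst.
  apply: (@continuous_comp _ _ _ (fun u : R => 2^-1 - u) (@powR R ^~ (p^-1 - 1))).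
    by apply: cvgB; [exact: cvg_cst|exact: cvg_id].
  by apply: powR_continuous; rewrite subr_gt0.
apply: cvg_trans; apply: near_eq_cvg; near=> u.
by rewrite E//; near: u; exact: lt_nbhsl.
Unshelve. all: by end_near. Qed.

(** The substitution r = (1/2 - x)^(1/p) maps [-s, s] onto the interval of
    integration and turns dr / r into - dx / (p (1/2 - x)).  As
    [action_density] is even in x, summing over x and -x replaces
    1 / (1/2 - x) by 1 / (1/4 - x^2). *)
Lemma gp_action_density v : 0 < v <= vmax p ->
  gp p v = \int[lebesgue_measure]_(x in `[0, action_end v])
    (action_density v x * (2 / p / (4^-1 - x ^+ 2))).
Proof.
move=> /[dup] vm /andP[v0 vmx].
have vm' : 0 <= v <= vmax p by rewrite ltW.
have /andP[s0 s1] := action_end_lt v0.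
rewrite /gp -/(action_end v); set s := action_end v in s0 s1 *.
have Ns1 : - 2^-1 < - s by rewrite ltrN2.
have h2 : 0 < 2^-1 :> R by lra.
set G := fun r => Num.sqrt _.
have -> : (2^-1 - s) `^ p^-1 = F s by [].
have -> : (2^-1 + s) `^ p^-1 = F (- s) by rewrite /F opprK.
pose K x := action_density v x * (p^-1 / (2^-1 - x)).
have cK : cont_half K.
  apply: cont_halfM; first exact: action_density_cont.
  apply: cont_halfM; first exact: cont_half_cst.
  apply: cont_halfV => [x /andP[? ?]|]; first by lra.
  by move=> x _; apply: cvgB; [exact: cvg_cst|exact: cvg_id].
have -> : \int[lebesgue_measure]_(r in `[F s, F (- s)]) G r =
    \int[lebesgue_measure]_(x in `[- s, s]) K x.
  rewrite /Rintegral; congr fine.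
  rewrite (@integration_by_substitution_decreasing _ F G (- s) s); first last.
  - apply: continuous_in_subspaceT => r; rewrite inE/= in_itv/= => /andP[r0 r1].
    have Fs0 : 0 < F s by apply: powR_gt0; rewrite subr_gt0.
    apply: gp_integrand_continuous; rewrite (lt_le_trans Fs0 r0)/=.
    apply: le_lt_trans r1 _; rewrite /F opprK.
    suff : (2^-1 + s) `^ p^-1 < 1 `^ p^-1 by rewrite powR1.
    by apply: gt0_ltr_powR; rewrite ?nnegrE ?invr_gt0//; lra.
  - split.
    + move=> x; rewrite in_itv/= => /andP[_ xs].
      by have [] := dF (lt_trans xs s1).
    + by apply: cvg_at_right_filter; apply: cF; lra.
    + by apply: cvg_at_left_filter; apply: cF.
  - by apply/cvg_ex; exists (F^`()%classic s); apply: cvg_at_left_filter; apply: cdF.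
  - apply/cvg_ex; exists (F^`()%classic (- s)).
    by apply: cvg_at_right_filter; apply: cdF; lra.
  - by move=> x; rewrite in_itv/= => /andP[_ xs]; apply: cdF; exact: lt_trans s1.
  - move=> x y; rewrite !in_itv/= => /andP[? ?] /andP[? ?] xy.
    apply: gt0_ltr_powR; rewrite ?nnegrE ?invr_gt0 ?ltrD2l ?ltrN2//; lra.
  - by lra.
  apply: eq_integral => x; rewrite inE/= in_itv/= => /andP[x1 x2]; congr EFin.
  have xh : x < 2^-1 by lra.
  rewrite !fctE/=.
  have -> : F^`()%classic x = F' x by rewrite derive1E; have [] := dF xh.
  have t0 : 0 < 2^-1 - x by lra.
  have u0 : 0 <= 2^-1 + x by lra.
  rewrite opprK /G /K.
  have -> : F x `^ p = 2^-1 - x.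
    by rewrite /F -powRrM mulVf ?gt_eqF// powRr1// ltW.
  have -> : p^-1 * (2^-1 - x) `^ (p^-1 - 1) = F x * (p^-1 / (2^-1 - x)).
    rewrite powRB; last by rewrite (gt_eqF t0) implybT.
    by rewrite powRr1 ?(ltW t0)// /F; ring.
  rewrite mulrA; congr (_ * _).
  have F0 : 0 < F x by apply: powR_gt0.
  rewrite -[X in _ * X](gtr0_norm F0) -sqrtr_sqr mulrC -sqrtrM ?sqr_ge0//.
  congr Num.sqrt; rewrite mulrBr mulrCA divff ?expf_neq0 ?gt_eqF// mulr1.
  congr (_ - _).
  have -> : F x ^+ 2 = (2^-1 - x) `^ (2 / p).
    by rewrite /F -powR_mulrn ?powR_ge0// -powRrM mulrC.
  rewrite -powRM ?(ltW t0)//; last by lra.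
  by congr (_ `^ _); field.
rewrite Rintegral_symm ?s0// -RintegralZl//=; last first.
  apply: cont_half_integrable => //.
  by apply: cont_halfD => //; exact: cont_half_opp.
apply: eq_Rintegral_half => x /andP[x0 x1].
rewrite /K /action_density sqrrN opprK.
set S := Num.sqrt _.
have q0 : 4^-1 - x ^+ 2 != 0 by rewrite gt_eqF// quarter_gt0//; apply/andP; split; lra.
field.
by apply/and4P; split; rewrite lt0r_neq0 //; nra.
Qed.
End Action.

(** * A primitive for the ball *)

Section PointwiseDerivatives.
Context (R : realType).
Implicit Types (f g : R -> R) (x a b : R).

Lemma derD f g x a b : is_derive x 1 f a -> is_derive x 1 g b ->
  is_derive x 1 (fun y => f y + g y) (a + b).
Proof. exact: is_deriveD. Qed.

Lemma derB f g x a b : is_derive x 1 f a -> is_derive x 1 g b ->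
  is_derive x 1 (fun y => f y - g y) (a - b).
Proof. exact: is_deriveB. Qed.

Lemma derM f g x a b : is_derive x 1 f a -> is_derive x 1 g b ->
  is_derive x 1 (fun y => f y * g y) (f x * b + g x * a).
Proof. exact: is_deriveM. Qed.

Lemma derV f x a : is_derive x 1 f a -> f x != 0 ->
  is_derive x 1 (fun y => (f y)^-1) (- (f x) ^- 2 * a).
Proof. by move=> df f0; exact: is_deriveV. Qed.

Lemma derC f g x a b : is_derive x 1 g b -> is_derive (g x) 1 f a ->
  is_derive x 1 (fun y => f (g y)) (a * b).
Proof. by move=> dg df; exact: (is_derive1_comp df dg). Qed.

Lemma der_cst c x : is_derive x 1 (fun=> c : R) 0.
Proof. exact: is_derive_cst. Qed.

Lemma der_id x : is_derive x 1 (fun y : R => y) 1.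
Proof. exact: is_derive_id. Qed.

Lemma der_sqr x : is_derive x 1 (fun y : R => y ^+ 2) (2 * x).
Proof.
by apply: is_derive_eq (derM (der_id x) (der_id x)) _; ring.
Qed.
End PointwiseDerivatives.

Section Arcsin.
Context (R : realType).

(** Half-angle form of the inverse sine.  It is continuous on the whole line, so
    the primitives built from it are continuous up to the end points. *)
Definition arcsin (x : R) : R := 2 * atan (x / (1 + Num.sqrt (1 - x ^+ 2))).

Lemma arcsin0 : arcsin 0 = 0.
Proof. by rewrite /arcsin mul0r atan0 mulr0. Qed.

Lemma arcsin1 : arcsin 1 = pi / 2.
Proof. by rewrite /arcsin expr1n subrr sqrtr0 addr0 divr1 atan1; field. Qed.

Lemma continuous_arcsin : continuous arcsin.
Proof.
move=> x; apply: cvgM; first exact: cvg_cst.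
apply: continuous_comp; last exact: continuous_atan.
apply: cvgM; first exact: cvg_id.
apply: cvgV; first by rewrite gt_eqF// ltr_pwDl// sqrtr_ge0.
by apply: cvgD; [exact: cvg_cst|exact: sqrt_1Bsqr_continuous].
Qed.

Lemma is_derive_arcsin (x : R) : -1 < x < 1 ->
  is_derive x 1 arcsin (Num.sqrt (1 - x ^+ 2))^-1.
Proof.
move=> /andP[x0 x1].
have q0 : 0 < 1 - x ^+ 2 by nra.
have d1 := derC (derB (der_cst 1 x) (der_sqr x)) (is_derive1_sqrt q0).
have d2 := derD (der_cst 1 x) d1.
have nz : 1 + Num.sqrt (1 - x ^+ 2) != 0 by rewrite gt_eqF// ltr_pwDl// sqrtr_ge0.
have d3 := derM (der_id x) (derV d2 nz).
have d4 := derM (der_cst 2 x) (derC d3 (is_derive1_atan _)).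
apply: is_derive_eq d4 _ => /=.
have c0 : 0 < Num.sqrt (1 - x ^+ 2) by rewrite sqrtr_gt0.
have x2 : x ^+ 2 = 1 - Num.sqrt (1 - x ^+ 2) ^+ 2 by rewrite sqr_sqrtr ?(ltW q0)//; ring.
move: (Num.sqrt _) c0 x2 {d1 d2 d3 nz} => c c0 x2.
have nz : 1 + c != 0 by rewrite gt_eqF//; lra.
have cn : c != 0 by rewrite gt_eqF.
have -> : 1 + (x / (1 + c)) ^+ 2 = 2 / (1 + c).
  by rewrite expr_div_n x2; field.
have -> : x * (- (1 + c) ^- 2 * (0 + (2 * c)^-1 * (0 - 2 * x))) + (1 + c)^-1 * 1
   = x ^+ 2 * ((1 + c) ^- 2 / c) + (1 + c)^-1.
  by field; rewrite nz cn.
by rewrite x2; field; rewrite nz cn.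
Qed.
End Arcsin.

Section DiskPrimitive.
Context (R : realType) (k : R).
Hypothesis k01 : 0 < k < 1.

(** Put t = sqrt (1 - k^2) sin theta.  Then sqrt (1 - k^2 - t^2) / (1 - t^2) dt
    becomes (1 - k^2 / (cos^2 theta + k^2 sin^2 theta)) d theta, whose primitive
    theta - k atan (k tan theta) is written here with inverse sines. *)
Definition disk_primitive (t : R) : R :=
  arcsin (t / Num.sqrt (1 - k ^+ 2)) -
  k * arcsin (k * t / (Num.sqrt (1 - k ^+ 2) * Num.sqrt (1 - t ^+ 2))).

Let kap := Num.sqrt (1 - k ^+ 2).

Let kap_gt0 : 0 < kap.
Proof. by rewrite sqrtr_gt0; case/andP: k01 => ? ?; nra. Qed.

Let kap2 : kap ^+ 2 = 1 - k ^+ 2.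
Proof. by rewrite sqr_sqrtr//; case/andP: k01 => ? ?; nra. Qed.

Lemma disk_primitive0 : disk_primitive 0 = 0.
Proof. by rewrite /disk_primitive !(mulr0, mul0r) arcsin0 mulr0 subrr. Qed.

Lemma disk_primitive_end : disk_primitive kap = pi / 2 * (1 - k).
Proof.
have [k0 _] := andP k01.
rewrite /disk_primitive -/kap kap2 divff ?gt_eqF// subKr sqrtr_sqr gtr0_norm//.
rewrite (mulrC kap) divff ?mulf_neq0 ?gt_eqF// arcsin1; ring.
Qed.

Lemma disk_primitive_continuous (t : R) : t ^+ 2 < 1 -> {for t, continuous disk_primitive}.
Proof.
move=> t1; apply: cvgB.
  apply: (@continuous_comp _ _ _ (fun t : R => t / kap) (@arcsin R)).
    by apply: cvgM; [exact: cvg_id|exact: cvg_cst].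
  exact: continuous_arcsin.
apply: cvgM; first exact: cvg_cst.
apply: (@continuous_comp _ _ _
  (fun t : R => k * t / (kap * Num.sqrt (1 - t ^+ 2))) (@arcsin R)); last first.
  exact: continuous_arcsin.
apply: cvgM; first by apply: cvgM; [exact: cvg_cst|exact: cvg_id].
apply: cvgV; first by rewrite mulf_neq0 ?gt_eqF// sqrtr_gt0 subr_gt0.
by apply: cvgM; [exact: cvg_cst|exact: sqrt_1Bsqr_continuous].
Qed.

Lemma is_derive_disk_primitive (t : R) : 0 < t < kap ->
  is_derive t 1 disk_primitive (Num.sqrt (1 - t ^+ 2 - k ^+ 2) / (1 - t ^+ 2)).
Proof.
have [k0 k1] := andP k01; move=> /andP[t0 tk].
have tk2 : t ^+ 2 < 1 - k ^+ 2 by rewrite -kap2 ltr_pXn2r// nnegrE ltW.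
have q0 : 0 < 1 - t ^+ 2 by nra.
have q1 : 0 < 1 - t ^+ 2 - k ^+ 2 by lra.
have c0 : 0 < Num.sqrt (1 - t ^+ 2) by rewrite sqrtr_gt0.
have c2 := sqr_sqrtr (ltW q0).
have e0 : 0 < Num.sqrt (1 - t ^+ 2 - k ^+ 2) by rewrite sqrtr_gt0.
have e2 := sqr_sqrtr (ltW q1).
have i1 : -1 < t / kap < 1.
  by rewrite ltr_pdivrMr// mul1r tk andbT (lt_trans (@ltrN10 R))// divr_gt0.
have s1 : Num.sqrt (1 - (t / kap) ^+ 2) = Num.sqrt (1 - t ^+ 2 - k ^+ 2) / kap.
  rewrite (_ : 1 - (t / kap) ^+ 2 = (Num.sqrt (1 - t ^+ 2 - k ^+ 2) / kap) ^+ 2).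
    by rewrite sqrtr_sqr gtr0_norm// divr_gt0.
  by rewrite !expr_div_n e2 kap2; field; rewrite -kap2 expf_neq0// gt_eqF.
pose y u := k * u / (kap * Num.sqrt (1 - u ^+ 2)).
have s2 : Num.sqrt (1 - y t ^+ 2) =
    Num.sqrt (1 - t ^+ 2 - k ^+ 2) / (kap * Num.sqrt (1 - t ^+ 2)).
  have kc0 : 0 < kap * Num.sqrt (1 - t ^+ 2) by rewrite mulr_gt0.
  rewrite (_ : 1 - y t ^+ 2 =
      (Num.sqrt (1 - t ^+ 2 - k ^+ 2) / (kap * Num.sqrt (1 - t ^+ 2))) ^+ 2).
    by rewrite sqrtr_sqr gtr0_norm// divr_gt0.
  rewrite /y !expr_div_n !exprMn e2 kap2 c2; field.
  by rewrite -kap2 expf_neq0 ?gt_eqF.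
have y0 : 0 < y t by rewrite !(mulr_gt0, invr_gt0).
have i2 : -1 < y t < 1.
  rewrite (lt_trans (@ltrN10 R))//= ltNge; apply/negP => y1.
  suff : Num.sqrt (1 - y t ^+ 2) = 0.
    by rewrite s2 => /eqP; rewrite gt_eqF// divr_gt0// mulr_gt0.
  by apply: ler0_sqrtr; nra.
have d1 := derC (derM (der_id t) (der_cst kap^-1 t)) (is_derive_arcsin i1).
have dc := derC (derB (der_cst 1 t) (der_sqr t)) (is_derive1_sqrt q0).
have dk := derM (der_cst kap t) dc.
have nz : kap * Num.sqrt (1 - t ^+ 2) != 0 by rewrite mulf_neq0 ?gt_eqF.
have dy := derM (derM (der_cst k t) (der_id t)) (derV dk nz).
have d2 := derM (der_cst k t) (derC dy (is_derive_arcsin i2)).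
apply: is_derive_eq (derB d1 d2) _ => /=.
rewrite s1 s2.
have t2 : t ^+ 2 = 1 - Num.sqrt (1 - t ^+ 2) ^+ 2 by rewrite c2; ring.
have k2 : k ^+ 2 = Num.sqrt (1 - t ^+ 2) ^+ 2 - Num.sqrt (1 - t ^+ 2 - k ^+ 2) ^+ 2.
  by rewrite c2 e2; ring.
move: (Num.sqrt (1 - t ^+ 2 - k ^+ 2)) (Num.sqrt (1 - t ^+ 2)) c0 e0 t2 k2
  {c2 e2 dc dk nz s1 s2 i1} => e c c0 e0 t2 k2.
have cn : c != 0 by rewrite gt_eqF.
have en : e != 0 by rewrite gt_eqF.
have kn : kap != 0 by rewrite gt_eqF.
move: (kap) kn => K kn.
transitivity (e^-1 - k ^+ 2 * (c ^+ 2 + t ^+ 2) / (e * c ^+ 2)).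
  by field; rewrite cn en kn.
by rewrite k2 t2 subKr; field; rewrite cn en.
Qed.
End DiskPrimitive.

(** * The weight comparing p with 2 *)

Section Reference.
Context (R : realType) (p : R).
Hypothesis p_ge1 : 1 <= p.

Let p_gt0 : 0 < p. Proof. exact: lt_le_trans p_ge1. Qed.
Let b := 2 / p.
Let b_gt0 : 0 < b. Proof. exact: divr_gt0. Qed.

(** For x > 0 this is tau / (2 x), where 1 - tau^2 = (1 - 4 x^2)^(2/p): the
    variable tau is to the exponent 2 what 2 x is to the exponent p.  Written
    with a chord slope, it is regular at x = 0. *)
Definition ball_weight (x : R) : R := Num.sqrt (chord_slope b (4 * x ^+ 2)).

Let sqr4_lt1 (x : R) : -2^-1 < x < 2^-1 -> 0 <= 4 * x ^+ 2 < 1.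
Proof. by move=> /andP[? ?]; apply/andP; split; nra. Qed.

Lemma chord_slope_gt0 (x : R) : 0 <= x < 1 -> 0 < chord_slope b x.
Proof.
move=> /(chord_slope_bounds b_gt0)[h1 h2].
have [/h1/andP[h _]|/ltW/h2/andP[h _]] := leP 1 b; first exact: lt_le_trans h.
exact: lt_le_trans h.
Qed.

Lemma ball_weight_gt0 (x : R) : -2^-1 < x < 2^-1 -> 0 < ball_weight x.
Proof. by move=> /sqr4_lt1 x1; rewrite sqrtr_gt0 chord_slope_gt0. Qed.

Lemma ball_weight_cont : cont_half ball_weight.
Proof.
apply: cont_half_sqrt => x x1.
apply: (@continuous_comp _ _ _ (fun x : R => 4 * x ^+ 2) (chord_slope b)).
  by apply: cont_halfM x1; [exact: cont_half_cst|exact: cont_half_sqr].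
by apply: chord_slope_continuous => //; case/andP: (sqr4_lt1 x1).
Qed.

Let tau (x : R) : R := Num.sqrt (1 - (1 - 4 * x ^+ 2) `^ b).

Let tau2 (x : R) : -2^-1 < x < 2^-1 -> tau x ^+ 2 = 1 - (1 - 4 * x ^+ 2) `^ b.
Proof.
move=> /sqr4_lt1 /[dup] x1 /andP[x0 _]; rewrite sqr_sqrtr// -chord_slopeE//.
by rewrite mulr_ge0// ltW// chord_slope_gt0.
Qed.

Let tauE (x : R) : 0 <= x < 2^-1 -> tau x = 2 * x * ball_weight x.
Proof.
move=> /andP[x0 x1]; rewrite /tau -chord_slopeE//.
have -> : 4 * x ^+ 2 = (2 * x) ^+ 2 by ring.
by rewrite sqrtrM ?sqr_ge0// sqrtr_sqr ger0_norm ?mulr_ge0// /ball_weight exprMn -natrX.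
Qed.

Let tau_cont : cont_half tau.
Proof.
apply: cont_half_sqrt; apply: cont_halfD; first exact: cont_half_cst.
apply: cont_halfN; apply: cont_half_powR.
  by move=> u /sqr4_lt1/andP[_]; rewrite subr_gt0.
apply: cont_halfD; first exact: cont_half_cst.
by apply: cont_halfN; apply: cont_halfM; [exact: cont_half_cst|exact: cont_half_sqr].
Qed.

Let m := vmax p.
Let m_gt0 : 0 < m. Proof. exact: vmax_gt0. Qed.

Let quarter_powR (x : R) : -2^-1 < x < 2^-1 ->
  (4^-1 - x ^+ 2) `^ b = m ^+ 2 * (1 - 4 * x ^+ 2) `^ b.
Proof.
move=> /sqr4_lt1/andP[x0 x1].
rewrite -(powR_p2 p_ge1 (ltW m_gt0)) vmax_powR// -powRM ?invr_ge0//; last by lra.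
by congr (_ `^ _); field.
Qed.

(** In the variable tau the integrand is the one of the ball, up to the scale
    m = vmax p: it is 2 m sqrt (1 - k^2 - tau^2) / (1 - tau^2) d tau with
    k = v / m, so that [disk_primitive] yields 2 m (pi / 2) (1 - k). *)
Lemma ball_weight_integral v : 0 < v <= m ->
  \int[lebesgue_measure]_(x in `[0, action_end p v])
    (action_density p v x * (2 / p / (4^-1 - x ^+ 2)) / ball_weight x) =
  pi * (m - v).
Proof.
move=> /andP[v0]; rewrite le_eqVlt => /predU1P[->|vm].
  rewrite /action_end vmax_powR// subrr sqrtr0 set_itv1 Rintegral_set1 subrr.
  by rewrite mulr0.
have /andP[_ s1] := action_end_lt p v0.
have s2 : action_end p v ^+ 2 = 4^-1 - v `^ p.
  by rewrite sqr_sqrtr// subr_ge0 powR_quarter// !ltW.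
have s0 : 0 < action_end p v.
  rewrite sqrtr_gt0 subr_gt0 -(vmax_powR p_ge1).
  by apply: gt0_ltr_powR; rewrite ?nnegrE// ltW.
set s := action_end p v in s0 s1 s2 *.
set D := fun x => _ / ball_weight x.
pose k := v / m.
have k01 : 0 < k < 1 by rewrite divr_gt0// ltr_pdivrMr// mul1r.
have vE : v = m * k by rewrite /k mulrC divfK// gt_eqF.
pose F x := 2 * m * disk_primitive k (tau x).
have half x : 0 <= x -> x <= s -> -2^-1 < x < 2^-1.
  by move=> x0 xs; apply/andP; split; lra.
have cD : cont_half D.
  apply: cont_halfM; last apply: cont_halfV => [x x1|].
  - apply: cont_halfM; first exact: action_density_cont.
    apply: cont_halfM; first exact: cont_half_cst.
    apply: cont_halfV; first by move=> x /quarter_gt0 /lt0r_neq0.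
    apply: cont_halfD; first exact: cont_half_cst.
    exact/cont_halfN/cont_half_sqr.
  - by rewrite gt_eqF// ball_weight_gt0.
  - exact: ball_weight_cont.
have cF x : 0 <= x -> x <= s -> {for x, continuous F}.
  move=> x0 xs; have x1 := half _ x0 xs.
  apply: cvgM; first exact: cvg_cst.
  apply: (@continuous_comp _ _ _ tau (disk_primitive k)); first exact: tau_cont.
  apply: disk_primitive_continuous => //.
  rewrite tau2// ltrBlDr ltrDl powR_gt0//.
  by have /andP[_] := sqr4_lt1 x1; rewrite subr_gt0.
have dF x : 0 < x -> x < s -> is_derive x 1 F (D x).
  move=> x0 xs; have x1 := half _ (ltW x0) (ltW xs).
  have /andP[_ x2] := sqr4_lt1 x1.
  have q0 : 0 < 1 - 4 * x ^+ 2 by rewrite subr_gt0.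
  have tE : tau x = 2 * x * ball_weight x.
    by apply: tauE; rewrite (ltW x0)/=; case/andP: x1.
  have W0 := ball_weight_gt0 x1.
  have t0 : 0 < tau x by rewrite tE !mulr_gt0.
  have r0 : 0 < 1 - (1 - 4 * x ^+ 2) `^ b by rewrite -tau2// exprn_gt0.
  have tk : k ^+ 2 < (1 - 4 * x ^+ 2) `^ b.
    rewrite -(ltr_pM2l (exprn_gt0 2 m_gt0)) -quarter_powR// -exprMn -vE.
    rewrite -(powR_p2 p_ge1 (ltW v0)).
    have vp : v `^ p < 4^-1 - x ^+ 2.
      have : x ^+ 2 < s ^+ 2 by rewrite ltr_pXn2r// nnegrE ltW.
      by rewrite s2; lra.
    apply: gt0_ltr_powR; rewrite ?nnegrE ?powR_ge0//.
    by rewrite ltW// (le_lt_trans (powR_ge0 _ _) vp).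
  have tlt : tau x < Num.sqrt (1 - k ^+ 2).
    by rewrite ltr_sqrt ?ltrD2l ?ltrN2//; case/andP: k01 => ? ?; nra.
  have d1 := derB (der_cst 1 x) (derM (der_cst 4 x) (der_sqr x)).
  have d2 := derB (der_cst 1 x) (derC d1 (is_derive1_powR b q0)).
  have d3 := derC d2 (is_derive1_sqrt r0).
  have tk' : 0 < tau x < Num.sqrt (1 - k ^+ 2) by rewrite t0.
  have d4 := derC d3 (is_derive_disk_primitive k01 tk').
  apply: is_derive_eq (derM (der_cst (2 * m) x) d4) _ => /=.
  rewrite -/(tau x) tau2// subKr.
  have SE : action_density p v x = m * Num.sqrt ((1 - 4 * x ^+ 2) `^ b - k ^+ 2).
    rewrite /action_density -/b quarter_powR// {1}vE exprMn -mulrBr.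
    by rewrite sqrtrM ?sqr_ge0// sqrtr_sqr gtr0_norm.
  rewrite /D SE tE -/b.
  set S := Num.sqrt _.
  have -> : (1 - 4 * x ^+ 2) `^ b = (1 - 4 * x ^+ 2) * (1 - 4 * x ^+ 2) `^ (b - 1).
    by rewrite mulr_powRB1// ltW.
  have P0 := powR_gt0 (b - 1) q0.
  move: (_ `^ (b - 1)) P0 => P P0.
  move: (ball_weight x) W0 {tE} => W W0.
  have -> : 4^-1 - x ^+ 2 = (1 - 4 * x ^+ 2) / 4 by field.
  have Q0 : 1 - 4 * x ^+ 2 != 0 by rewrite gt_eqF.
  move: (1 - 4 * x ^+ 2) Q0 => Q Q0.
  by field; rewrite Q0 !gt_eqF.
rewrite /Rintegral (@continuous_FTC2 _ D F)//; first last.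
- move=> x; rewrite in_itv/= => /andP[x0 xs].
  by rewrite derive1E; have [] := dF _ x0 xs.
- split.
  + by move=> x; rewrite in_itv/= => /andP[x0 xs]; have [] := dF _ x0 xs.
  + by apply: cvg_at_right_filter; apply: cF => //; exact: ltW.
  + by apply: cvg_at_left_filter; apply: cF => //; exact: ltW.
- by apply: cont_half_within => //; lra.
rewrite /= /F /tau expr0n/= mulr0 subr0 powR1 subrr sqrtr0.
rewrite disk_primitive0 mulr0 subr0.
have -> : (1 - 4 * s ^+ 2) `^ b = k ^+ 2.
  have h : (4^-1 - s ^+ 2) `^ b = v ^+ 2 by rewrite s2 subKr powR_p2// ltW.
  apply: (mulfI (lt0r_neq0 (exprn_gt0 2 m_gt0))).
  by rewrite -quarter_powR ?h ?half ?(ltW s0)// vE exprMn.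
by rewrite (disk_primitive_end k01) vE; field.
Qed.
End Reference.

(** * Continuity of the action function at zero *)

Section AtZero.
Context (R : realType) (p : R).
Hypothesis p_ge1 : 1 <= p.

Let p_gt0 : 0 < p. Proof. exact: lt_le_trans p_ge1. Qed.
Let f (v r : R) := Num.sqrt ((1 - r `^ p) `^ (2 / p) - v ^+ 2 / r ^+ 2).
Let mu := @lebesgue_measure R.

Let f_bound v r : 0 < r < 1 -> 0 <= f v r <= 1.
Proof.
move=> /(powR_itv01 p_ge1)/andP[r0 r1]; rewrite sqrtr_ge0/= -[leRHS]sqrtr1 ler_wsqrtr//.
have h : (1 - r `^ p) `^ (2 / p) <= 1 `^ (2 / p).
  apply: ge0_ler_powR; rewrite ?nnegrE ?divr_ge0 ?(ltW p_gt0)//; lra.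
rewrite powR1 in h; apply: le_trans h; rewrite gerBl.
by rewrite divr_ge0// sqr_ge0.
Qed.

Let f_meas (v : R) : measurable_fun (`]0, 1[%classic : set R) (f v).
Proof.
apply: open_continuous_measurable_fun; first exact: interval_open.
by move=> r; rewrite inE/= in_itv/=; exact: gp_integrand_continuous.
Qed.

Let cst_int (a b c : R) : mu.-integrable `[a, b] (EFin \o cst c).
Proof.
apply: continuous_compact_integrable; first exact: segment_compact.
by apply: continuous_subspaceT => x; exact: cvg_cst.
Qed.

Let f_int (v : R) : mu.-integrable `]0, 1[ (EFin \o f v).
Proof.
apply: measurable_bounded_integrable => //.
- by rewrite /= lebesgue_measure_itv/= lte_fin ltr01 -EFinD ltry.
- exact: f_meas.
- exists 1; split=> // M M1 r; rewrite /= in_itv/= => /(f_bound v)/andP[h0 h1].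
  by rewrite ger0_norm// (le_trans h1)// ltW.
Qed.

(** Where r is outside the interval of integration of [gp p v], the radicand is
    not positive.  Integrating over ]0, 1[ makes different v comparable. *)
Let gp_unit_interval (v : R) : 0 <= v <= vmax p ->
  gp p v = 2 * \int[mu]_(r in `]0, 1[) f v r.
Proof.
move=> /[dup] vm /andP[]; rewrite le_eqVlt => /predU1P[<- _|v0 vmx].
  rewrite /gp powR0 ?gt_eqF// subr0.
  have -> : Num.sqrt 4^-1 = 2^-1 :> R.
    by rewrite (_ : 4^-1 = 2^-1 ^+ 2); [rewrite sqrtr_sqr ger0_norm|field].
  rewrite subrr powR0 ?invr_eq0 ?gt_eqF//.
  have -> : 2^-1 + 2^-1 = 1 :> R by field.
  rewrite powR1; congr (_ * _).
  have m1 := f_meas 0; have m2 := (measurable_fun_itv_obnd_cbndP _ _ _).1 m1.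
  rewrite /Rintegral -integral_itv_bndo_bndc; last exact/measurable_EFinP.
  by rewrite -integral_itv_obnd_cbnd//; exact/measurable_EFinP.
rewrite /gp; congr (_ * _).
set s := Num.sqrt _.
have /andP[s0 s1] : 0 <= s < 2^-1 := action_end_lt p v0.
have s2 : s ^+ 2 = 4^-1 - v `^ p by rewrite sqr_sqrtr// subr_ge0 powR_quarter.
have ends (t : R) : 0 <= t -> (t `^ p^-1) `^ p = t.
  by move=> t0; rewrite -powRrM mulVf ?gt_eqF// powRr1.
have sp : 0 < s + 2^-1 by lra.
rewrite Rintegral_mkcond [RHS]Rintegral_mkcond; congr Rintegral.
apply/funext => r; rewrite !patchE.
have [r01|] := boolP (r \in `]0, 1[%classic); last first.
  rewrite !notin_setE/= !in_itv/= => r01; rewrite ifF//.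
  apply/negbTE; rewrite notin_setE/= in_itv/=; apply: contra_not r01.
  move=> /andP[h1 h2]; apply/andP; split.
    by apply: lt_le_trans h1; apply: powR_gt0; rewrite subr_gt0.
  apply: le_lt_trans h2 _.
  have : (2^-1 + s) `^ p^-1 < 1 `^ p^-1.
    by apply: gt0_ltr_powR; rewrite ?nnegrE ?invr_gt0//; lra.
  by rewrite powR1.
move: r01; rewrite inE/= in_itv/= => /[dup] r01 /andP[r0 r1].
case: ifPn => //; rewrite notin_setE/= in_itv/= => /negP out.
apply/esym/ler0_sqrtr; rewrite subr_le0.
have /andP[t0 t1] := powR_itv01 p_ge1 r01.
rewrite ler_pdivlMr ?exprn_gt0//.
rewrite -(powR_p2 p_ge1 (ltW r0)) -powRM ?powR_ge0 ?subr_ge0 ?(ltW t1)//.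
rewrite -(powR_p2 p_ge1 (ltW v0)) ler_powR_mono ?divr_gt0 ?powR_ge0//; last first.
  by rewrite mulr_ge0 ?subr_ge0 ?(ltW t1) ?(ltW t0).
rewrite leNgt; apply: contra out => vt.
rewrite -(ler_powR_mono p_gt0) ?powR_ge0 ?(ltW r0)//.
rewrite -[X in _ && X](ler_powR_mono p_gt0) ?powR_ge0 ?(ltW r0)//.
rewrite !ends ?subr_ge0 ?(ltW s1)//; last by lra.
by apply/andP; split; nra.
Qed.

(** sqrt a <= x + sqrt (a - x^2), with x = v / r. *)
Let f_drop v r : 0 <= v -> 0 < r < 1 -> 0 <= f 0 r - f v r <= v / r.
Proof.
move=> v0 /[dup] r01 /andP[r0 r1].
have vr0 : 0 <= v / r by rewrite divr_ge0// ltW.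
have /andP[_ t1] := powR_itv01 p_ge1 r01.
rewrite /f expr0n/= mul0r subr0 -expr_div_n.
have := powR_ge0 (1 - r `^ p) (2 / p); move: (_ `^ (2 / p)) => a a0.
move: (v / r) vr0 => x x0; rewrite subr_ge0 lerBlDr; apply/andP; split.
  by apply: ler_wsqrtr; rewrite gerBl sqr_ge0.
rewrite -[leRHS]ger0_norm ?addr_ge0 ?sqrtr_ge0// -sqrtr_sqr ler_wsqrtr// sqrrD.
have [xa|ax] := leP (x ^+ 2) a; last first.
  rewrite (le_trans (ltW ax))// -addrA lerDl addr_ge0 ?sqr_ge0//.
  by rewrite mulrn_wge0// mulr_ge0// sqrtr_ge0.
rewrite sqr_sqrtr ?subr_ge0// addrAC subrKC.
by rewrite lerDl mulrn_wge0// mulr_ge0// sqrtr_ge0.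
Qed.

(** With v = e^2, the drop v / r of the integrand is at most e for r > e, and the
    drop is at most 1 on ]0, e]. *)
Lemma gp_near0 (e : R) : 0 < e < 1 -> e ^+ 2 <= vmax p ->
  `|gp p 0 - gp p (e ^+ 2)| <= 4 * e.
Proof.
move=> /andP[e0 e1] em; set v := e ^+ 2.
have v0 : 0 <= v by exact: sqr_ge0.
have m0 : 0 <= (0 : R) <= vmax p by apply/andP; split=> //; exact: ltW (vmax_gt0 p).
have mv : 0 <= v <= vmax p by rewrite v0.
rewrite (gp_unit_interval m0) (gp_unit_interval mv).
rewrite -mulrBr -RintegralB//=; [|exact: f_int..].
rewrite normrM ger0_norm//.
have hint : mu.-integrable `]0, 1[ (EFin \o (fun r => f 0 r - f v r)).
  by apply: eq_integrable (integrableB _ (f_int 0) (f_int v)) => // r _.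
rewrite ger0_norm; last first.
  apply: Rintegral_ge0 => r; rewrite /= in_itv/= => /(f_drop v0)/andP[//].
have := @Rintegral_itvB _ (fun r => f 0 r - f v r) (BRight 0) (BLeft 1) e hint.
rewrite !bnd_simp => /(_ (ltW e0) e1)/eqP; rewrite subr_eq => /eqP ->.
have h1 : \int[mu]_(r in `]e, 1[) (f 0 r - f v r) <= e.
  apply: (@le_trans _ _ (\int[mu]_(r in `]e, 1[) e)).
    apply: le_Rintegral => //=.
    - by apply: integrableS hint => //; apply: subset_itvr; rewrite bnd_simp ltW.
    - by apply: integrableS (cst_int e 1 e) => //; exact: subset_itv_oo_cc.
    - move=> r; rewrite in_itv/= => /andP[r0 r1].
      have r01 : 0 < r < 1 by rewrite (lt_trans e0).
      have /andP[_ h] := f_drop v0 r01; apply: le_trans h _.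
      by rewrite ler_pdivrMr ?(lt_trans e0)// /v expr2 ler_pM2l// ltW.
  rewrite Rintegral_cst//= /mu lebesgue_measure_itv/= lte_fin e1 -EFinD/=.
  by nra.
have h2 : \int[mu]_(r in `]0, e]) (f 0 r - f v r) <= e.
  apply: (@le_trans _ _ (\int[mu]_(r in `]0, e]) 1)).
    apply: le_Rintegral => //=.
    - by apply: integrableS hint => //; apply: subset_itvl; rewrite bnd_simp.
    - by apply: integrableS (cst_int 0 e 1) => //; exact: subset_itv_oc_cc.
    - move=> r; rewrite in_itv/= => /andP[r0 r1].
      have r01 : 0 < r < 1 by rewrite r0 (le_lt_trans r1).
      by have := f_bound 0 r01; have := f_bound v r01; move=> /andP[? ?] /andP[? ?]; lra.
  by rewrite Rintegral_cst//= /mu lebesgue_measure_itv/= lte_fin e0 -EFinD/= subr0 mul1r.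
have -> : 4 * e = 2 * (e + e) by ring.
by rewrite ler_pM2l ?lerD.
Qed.
End AtZero.

(** * Comparison with the ball *)

(** Beyond w^2 the gap is nonpositive because v |-> sqrt (q - v^2) is concave.
    Below w^2 the second root is 0, and the two others compare like
    t^2 (q - v^2) and q - u^2, whose difference is affine in q; z is its
    zero. *)
Lemma sqrt_crossing (R : realType) (t v w : R) :
  0 < t < 1 -> 0 <= v -> v < w ->
  exists2 z, (t * v + (1 - t) * w) ^+ 2 <= z <= w ^+ 2 & forall q,
    let gap := t * Num.sqrt (q - v ^+ 2) + (1 - t) * Num.sqrt (q - w ^+ 2)
               - Num.sqrt (q - (t * v + (1 - t) * w) ^+ 2) in
    (q <= z -> 0 <= gap) /\ (z <= q -> gap <= 0).
Proof.
move=> /andP[t0 t1] v0 vw; set u := t * v + (1 - t) * w.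
have t1' : 0 < 1 - t by lra.
have vu : v < u by rewrite /u; nra.
have uw : u < w by rewrite /u; nra.
have u0 : 0 <= u by lra.
have d0 : 0 < 1 - t ^+ 2 by nra.
pose z := (u ^+ 2 - t ^+ 2 * v ^+ 2) / (1 - t ^+ 2).
have zE : z * (1 - t ^+ 2) = u ^+ 2 - t ^+ 2 * v ^+ 2 by rewrite /z divfK// gt_eqF.
have uz : u ^+ 2 <= z.
  have vu2 : v ^+ 2 <= u ^+ 2 by rewrite ler_pXn2r// ?nnegrE// ltW.
  by rewrite -(ler_pM2r d0) zE; have := ler_wpM2l (sqr_ge0 t) vu2; lra.
have zw : z <= w ^+ 2.
  rewrite -(ler_pM2r d0) zE.
  have -> : u ^+ 2 - t ^+ 2 * v ^+ 2 = (1 - t) * w * (2 * t * v + (1 - t) * w).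
    by rewrite /u; ring.
  have -> : w ^+ 2 * (1 - t ^+ 2) = (1 - t) * w * (2 * t * w + (1 - t) * w) by ring.
  have k0 : 0 <= (1 - t) * w by nra.
  apply: (ler_wpM2l k0); rewrite lerD2r; nra.
have tS q : t * Num.sqrt (q - v ^+ 2) = Num.sqrt (t ^+ 2 * (q - v ^+ 2)).
  by rewrite sqrtrM ?sqr_ge0// sqrtr_sqr gtr0_norm.
exists z; first by rewrite uz.
move=> q gap; rewrite /gap {gap}; split=> [qz|zq].
  rewrite (@ler0_sqrtr _ (q - w ^+ 2)); last by lra.
  rewrite mulr0 addr0 subr_ge0 tS; apply: ler_wsqrtr.
  have := ler_wpM2r (ltW d0) qz; rewrite zE; lra.
rewrite subr_le0; have [qw|wq] := leP q (w ^+ 2).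
  rewrite (@ler0_sqrtr _ (q - w ^+ 2)); last by lra.
  rewrite mulr0 addr0 tS; apply: ler_wsqrtr.
  have := ler_wpM2r (ltW d0) zq; rewrite zE; lra.
have qv0 : 0 <= q - v ^+ 2 by nra.
have qw0 : 0 <= q - w ^+ 2 by lra.
have qu0 : 0 <= q - u ^+ 2 by nra.
have A2 := sqr_sqrtr qv0; have B2 := sqr_sqrtr qw0; have C2 := sqr_sqrtr qu0.
have A0 := sqrtr_ge0 (q - v ^+ 2); have B0 := sqrtr_ge0 (q - w ^+ 2).
have C0 := sqrtr_ge0 (q - u ^+ 2).
move: (Num.sqrt (q - v ^+ 2)) (Num.sqrt (q - w ^+ 2)) (Num.sqrt (q - u ^+ 2))
  A0 B0 C0 A2 B2 C2 => A B C A0 B0 C0 A2 B2 C2.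
have AB : A * B <= q - v * w.
  have q1 : 0 <= q - v * w by nra.
  rewrite -(@ler_pXn2r _ 2)// ?nnegrE ?mulr_ge0// exprMn A2 B2.
  have q0 : 0 <= q by nra.
  have := mulr_ge0 q0 (sqr_ge0 (v - w)); lra.
rewrite -(@ler_pXn2r _ 2)// ?nnegrE ?addr_ge0 ?mulr_ge0 ?(ltW t0) ?(ltW t1')//.
have -> : (t * A + (1 - t) * B) ^+ 2 =
  t ^+ 2 * A ^+ 2 + (1 - t) ^+ 2 * B ^+ 2 + 2 * (t * (1 - t)) * (A * B) by ring.
rewrite A2 B2 C2 /u.
have : 0 <= 2 * (t * (1 - t)) by rewrite !mulr_ge0// ltW.
move=> /ler_wpM2l /(_ _ _ AB); lra.
Qed.

Section Comparison.
Context (R : realType) (p : R).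
Hypothesis p_ge1 : 1 <= p.

Let p_gt0 : 0 < p. Proof. exact: lt_le_trans p_ge1. Qed.
Let b := 2 / p.
Let b_gt0 : 0 < b. Proof. exact: divr_gt0. Qed.
Let m := vmax p.
Let m_gt0 : 0 < m. Proof. exact: vmax_gt0. Qed.
Let W := ball_weight p.
(** The density for which S v integrates to pi (m - v). *)
Let rho (x : R) := b / (4^-1 - x ^+ 2) / W x.
Let S := action_density p.
Let I (s : R) (f : R -> R) := \int[lebesgue_measure]_(x in `[0, s]) f x.

Let rho_cont : cont_half rho.
Proof.
apply: cont_halfM; last first.
  apply: cont_halfV; last exact: ball_weight_cont.
  by move=> x /(ball_weight_gt0 p_ge1)/lt0r_neq0.
apply: cont_halfM; first exact: cont_half_cst.
apply: cont_halfV; first by move=> x /quarter_gt0 /lt0r_neq0.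
apply: cont_halfD; first exact: cont_half_cst.
exact/cont_halfN/cont_half_sqr.
Qed.

Let rho_ge0 x : -2^-1 < x < 2^-1 -> 0 <= rho x.
Proof.
move=> x1.
have q0 := ltW (quarter_gt0 x1); have w0 := ltW (ball_weight_gt0 p_ge1 x1).
exact: divr_ge0 (divr_ge0 (ltW b_gt0) q0) w0.
Qed.

(** S w vanishes on the part of the larger interval that is added, so several
    values of w can share one interval. *)
Let density_widen (c : R -> R) (v w : R) : 0 < v -> v <= w -> w <= m ->
  I (action_end p w) (fun x => S w x * c x) = I (action_end p v) (fun x => S w x * c x).
Proof.
move=> v0 vw wm; rewrite /I Rintegral_mkcond [RHS]Rintegral_mkcond.
congr Rintegral; apply/funext => x; rewrite !patchE.
have w0 := lt_le_trans v0 vw.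
have ends : action_end p w <= action_end p v.
  by rewrite ler_wsqrtr// lerD2l lerN2 ler_powR_mono// ltW.
have /andP[_ s1] := action_end_lt p v0.
have [|h] := boolP (x \in `[0, action_end p w]%classic).
  rewrite inE/= in_itv/= => /andP[x0 xw].
  by rewrite ifT// inE/= in_itv/= x0 (le_trans xw).
move: h; rewrite notin_setE/= in_itv/= => /negP h.
case: ifPn => //; rewrite inE/= in_itv/= => /andP[x0 xv].
move: h; rewrite x0/= le_action_end ?(ltW w0) ?x0 ?(le_lt_trans xv)// -ltNge => h.
by rewrite /S /action_density ler0_sqrtr ?mul0r// subr_le0 ltW.
Qed.

Let gpE (v w : R) : 0 < v -> v <= w -> w <= m ->
  gp p w = I (action_end p v) (fun x => S w x * (rho x * W x)).
Proof.
move=> v0 vw wm; rewrite -density_widen//.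
have w0 := lt_le_trans v0 vw; have /andP[_ s1] := action_end_lt p w0.
rewrite gp_action_density ?w0//; apply: eq_Rintegral_half => x /andP[x0 x1].
congr (_ * _); rewrite /rho divfK// gt_eqF// ball_weight_gt0//.
by apply/andP; split; lra.
Qed.

Let refE (v w : R) : 0 < v -> v <= w -> w <= m ->
  pi * (m - w) = I (action_end p v) (fun x => S w x * rho x).
Proof.
move=> v0 vw wm; rewrite -density_widen//.
have w0 := lt_le_trans v0 vw.
rewrite -ball_weight_integral ?w0//; apply: eq_Rintegral_half => x _.
by rewrite /rho [RHS]mulrA.
Qed.

Let I_lin (s c d : R) (f g : R -> R) : s < 2^-1 -> cont_half f -> cont_half g ->
  I s (fun x => c * f x + d * g x) = c * I s f + d * I s g.
Proof.
move=> s1 cf cg; have h0 : -2^-1 < 0 :> R by lra.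
have scale (e : R) h : cont_half h -> cont_half (fun x => e * h x).
  by move=> ch; apply: cont_halfM => //; exact: cont_half_cst.
rewrite /I RintegralD//=; first by rewrite !RintegralZl//=; exact: cont_half_integrable.
  by apply: cont_half_integrable => //; exact: scale.
by apply: cont_half_integrable => //; exact: scale.
Qed.

Let SrhoW_cont v : cont_half (fun x => S v x * (rho x * W x)).
Proof.
apply: cont_halfM; first exact: action_density_cont.
by apply: cont_halfM => //; exact: ball_weight_cont.
Qed.

Let Srho_cont v : cont_half (fun x => S v x * rho x).
Proof. by apply: cont_halfM => //; exact: action_density_cont. Qed.

Let lin_cont (c d : R) f g : cont_half f -> cont_half g ->
  cont_half (fun x => c * f x + d * g x).
Proof.
move=> cf cg; apply: cont_halfD; apply: cont_halfM => //; exact: cont_half_cst.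
Qed.

(** S v >= S w, so the bounds of W pass under the integral, where the constant
    weight gives pi (w - v). *)
Let gp_diff_bounds c C : (forall x, 0 <= x < 2^-1 -> c <= W x <= C) ->
  forall v w, 0 < v -> v <= w -> w <= m ->
  c * (pi * (w - v)) <= gp p v - gp p w <= C * (pi * (w - v)).
Proof.
move=> cC v w v0 vw wm.
have vm : v <= m by exact: le_trans wm.
have /andP[s0 s1] := action_end_lt p v0.
have gE : gp p v - gp p w = I (action_end p v)
    (fun x => 1 * (S v x * (rho x * W x)) + (-1) * (S w x * (rho x * W x))).
  by rewrite I_lin// -!gpE// mul1r mulN1r.
have rE (k : R) : k * (pi * (w - v)) = I (action_end p v)
    (fun x => k * (S v x * rho x) + (- k) * (S w x * rho x)).
  by rewrite I_lin// -!refE//; ring.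
rewrite gE !rE.
have pw x : 0 <= x <= action_end p v ->
    c * ((S v x - S w x) * rho x) <= (S v x - S w x) * rho x * W x
      <= C * ((S v x - S w x) * rho x).
  move=> /andP[x0 xs].
  have x1 : 0 <= x < 2^-1 by rewrite x0 (le_lt_trans xs).
  have /andP[h1 h2] := cC _ x1.
  have d0 : 0 <= (S v x - S w x) * rho x.
    apply: mulr_ge0; last by apply: rho_ge0; case/andP: x1 => ? ?; apply/andP; split; lra.
    rewrite subr_ge0 ler_wsqrtr// lerD2l lerN2 ler_pXn2r// nnegrE ltW//.
    exact: lt_le_trans vw.
  by rewrite ![_ * W x]mulrC !ler_wpM2r.
apply/andP; split; apply: le_Rintegral_half => //; try exact: lin_cont.
- by move=> x /pw/andP[h _]; lra.
- by move=> x /pw/andP[_ h]; lra.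
Qed.

(** The second difference N is nonpositive up to o and nonnegative afterwards, so
    e * N * (W - W o) >= 0 for a weight e * W that is nondecreasing; and N rho
    integrates to the second difference of an affine function, which is 0. *)
Let gp_conv_pos (e : R) :
    (forall x y, 0 <= x -> x <= y -> y < 2^-1 -> e * W x <= e * W y) ->
  forall t v w, 0 < t < 1 -> 0 < v -> v < w -> w <= m ->
  e * gp p (t * v + (1 - t) * w) <= t * (e * gp p v) + (1 - t) * (e * gp p w).
Proof.
move=> We t v w t01 v0 vw wm.
have [z /andP[uz zw] cross] := sqrt_crossing t01 (ltW v0) vw.
move: uz cross; set u := t * v + (1 - t) * w => uz cross.
have /andP[t0 t1] := t01.
have vu : v <= u by rewrite /u; nra.
have uw : u <= w by rewrite /u; nra.
have um : u <= m by exact: le_trans wm.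
have vm : v <= m by exact: le_trans um.
have u0 : 0 < u by exact: lt_le_trans vu.
have w0 : 0 < w by exact: lt_trans vw.
have z0 : 0 <= z by apply: le_trans uz; exact: sqr_ge0.
have zE : Num.sqrt z ^+ 2 = z by exact: sqr_sqrtr.
have y0 : 0 < Num.sqrt z.
  by rewrite sqrtr_gt0; apply: lt_le_trans uz; exact: exprn_gt0.
have ym : 0 <= Num.sqrt z <= m.
  rewrite sqrtr_ge0/= (le_trans _ wm)// -[leRHS]ger0_norm ?(ltW w0)//.
  by rewrite -sqrtr_sqr ler_wsqrtr.
have /andP[ho0 ho1] := action_end_lt p y0.
set o := action_end p (Num.sqrt z) in ho0 ho1.
have /andP[s0 s1] := action_end_lt p v0.
set s := action_end p v in s0 s1.
(* o is where (1/4 - x^2)^(2/p) crosses the value z of sqrt_crossing. *)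
pose N x := t * S v x + (1 - t) * S w x - S u x.
have key x : 0 <= x <= s -> e * (W o) * (N x * rho x) <= e * (N x * rho x * W x).
  move=> /andP[x0 xs].
  have x1 : x < 2^-1 by exact: le_lt_trans xs s1.
  have r0 : 0 <= rho x by apply: rho_ge0; apply/andP; split; lra.
  have := cross ((4^-1 - x ^+ 2) `^ (2 / p)); rewrite -/(N x) => -[c1 c2].
  have oE : (x <= o) = (z <= (4^-1 - x ^+ 2) `^ (2 / p)).
    by rewrite le_action_end ?zE ?x0.
  have : 0 <= e * (W x - W o) * N x.
    have [zq|qz] := leP z ((4^-1 - x ^+ 2) `^ (2 / p)).
      have := We _ _ x0 (_ : x <= o) ho1; rewrite oE => /(_ zq) h.
      by apply: mulr_le0; [lra|exact: c2].
    have ox : o <= x by rewrite ltW// ltNge oE -ltNge.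
    have h := We _ _ ho0 ox x1.
    by apply: mulr_ge0; [lra|exact/c1/ltW].
  move=> /(mulr_ge0 r0); lra.
have lin_comb c : cont_half c -> I s (fun x => N x * c x) =
    t * I s (fun x => S v x * c x) + (1 - t) * I s (fun x => S w x * c x)
    - I s (fun x => S u x * c x).
  move=> cc.
  have cS y : cont_half (fun x => S y x * c x).
    by apply: cont_halfM => //; exact: action_density_cont.
  rewrite -I_lin// -[X in _ - X]mul1r -mulNr -[X in X + _]mul1r -I_lin//; last first.
    exact: lin_cont.
  by apply: eq_Rintegral_half => x _; rewrite /N; ring.
have gN : I s (fun x => N x * (rho x * W x)) =
    t * gp p v + (1 - t) * gp p w - gp p u.
  rewrite lin_comb ?(@gpE v v) ?(@gpE v w) ?(@gpE v u)// ?(ltW vw)//.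
  by apply: cont_halfM => //; exact: ball_weight_cont.
have rN : I s (fun x => N x * rho x) = 0.
  by rewrite lin_comb// -(@refE v v) -?(@refE v w) -?(@refE v u)// ?(ltW vw)// /u; ring.
have N_cont : cont_half N.
  apply: cont_halfD; first by apply: lin_cont; exact: action_density_cont.
  by apply: cont_halfN; exact: action_density_cont.
have NW_cont : cont_half (fun x => N x * (rho x * W x)).
  by apply: cont_halfM => //; apply: cont_halfM => //; exact: ball_weight_cont.
have Nr_cont : cont_half (fun x => N x * rho x) by exact: cont_halfM.
have : e * W o * I s (fun x => N x * rho x) + 0 * I s (fun x => N x * rho x) <=
    e * I s (fun x => N x * (rho x * W x)) + 0 * I s (fun x => N x * rho x).
  rewrite -!I_lin//; apply: le_Rintegral_half => //; try exact: lin_cont.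
  by move=> x /key h; lra.
rewrite rN gN; lra.
Qed.

Let gp_near (eta del : R) : 0 < eta -> 0 < del ->
  exists v, [/\ 0 < v, v <= del, v <= m & `|gp p 0 - gp p v| <= eta].
Proof.
move=> eta0 del0.
pose e := Num.min (Num.min (eta / 4) del) (Num.min (2^-1) m).
have h1 : 0 < eta / 4 by lra.
have h2 : 0 < 2^-1 :> R by lra.
have e0 : 0 < e by rewrite !lt_min h1 del0 h2.
have [e1 e2 e3 e4] : [/\ e <= eta / 4, e <= del, e <= 2^-1 & e <= m].
  by split; rewrite /e !ge_min lexx ?orbT.
have ee : e ^+ 2 <= e by nra.
exists (e ^+ 2); split; [exact: exprn_gt0|lra|lra|].
apply: le_trans (gp_near0 p_ge1 _ _) _; last by lra.
- by rewrite e0/=; lra.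
- exact: le_trans ee e4.
Qed.

Let le_eps (K x y : R) : 0 < K -> (forall eta, 0 < eta -> x <= y + K * eta) -> x <= y.
Proof.
move=> K0 h; apply/ler_addgt0Pr => eta eta0.
by have := h (eta / K) (divr_gt0 eta0 K0); rewrite mulrC divfK// gt_eqF.
Qed.

Let gp_diff_bounds0 c C : 0 < c -> (forall x, 0 <= x < 2^-1 -> c <= W x <= C) ->
  forall v w, 0 <= v -> v <= w -> w <= m ->
  c * (pi * (w - v)) <= gp p v - gp p w <= C * (pi * (w - v)).
Proof.
move=> c0 cC v w; rewrite le_eqVlt => /predU1P[<-{v}|v0]; last exact: gp_diff_bounds.
rewrite le_eqVlt => /predU1P[<- _|w0 wm]; first by rewrite !subrr !mulr0 lexx.
have /(cC 0)/andP[cW WC] : 0 <= (0 : R) < 2^-1 by apply/andP; split; lra.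
have C0 : 0 < C := lt_le_trans c0 (le_trans cW WC).
have pi0 := @pi_gt0 R.
rewrite subr0; apply/andP; split.
  apply: (@le_eps (c * pi + 1)) => [|eta eta0]; first by have := mulr_gt0 c0 pi0; lra.
  have [|v [v0 vd vm]] := @gp_near eta (Num.min eta w) eta0; first by rewrite lt_min eta0.
  move: vd; rewrite le_min => /andP[ve vw]; rewrite ler_norml => /andP[h1 h2].
  have /andP[h3 _] := gp_diff_bounds cC v0 vw wm.
  have := ler_wpM2l (ltW (mulr_gt0 c0 pi0)) ve; lra.
apply: (@le_eps 1) => // eta eta0.
have [|v [v0 vd vm]] := @gp_near eta (Num.min eta w) eta0; first by rewrite lt_min eta0.
move: vd; rewrite le_min => /andP[ve vw]; rewrite ler_norml => /andP[h1 h2].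
have /andP[_ h3] := gp_diff_bounds cC v0 vw wm.
have := mulr_gt0 (mulr_gt0 C0 pi0) v0; lra.
Qed.

Let gp_convex c C (e : R) : 0 < c -> (forall x, 0 <= x < 2^-1 -> c <= W x <= C) ->
    e = 1 \/ e = -1 ->
    (forall x y, 0 <= x -> x <= y -> y < 2^-1 -> e * W x <= e * W y) ->
  convex_on `[0, m]%classic (fun v => e * gp p v).
Proof.
move=> c0 cC e1 We.
have /(cC 0)/andP[cW WC] : 0 <= (0 : R) < 2^-1 by apply/andP; split; lra.
have C0 : 0 < C := lt_le_trans c0 (le_trans cW WC).
have pi0 := @pi_gt0 R.
have step t v w : 0 < t < 1 -> 0 <= v -> v < w -> w <= m ->
    e * gp p (t * v + (1 - t) * w) <= t * (e * gp p v) + (1 - t) * (e * gp p w).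
  move=> t01; rewrite le_eqVlt => /predU1P[<-{v}|]; last exact: gp_conv_pos.
  move=> w0 wm; have /andP[t0 t1] := t01.
  rewrite mulr0 add0r.
  apply: (@le_eps (C * pi + 1)) => [|eta eta0]; first by have := mulr_gt0 C0 pi0; lra.
  have [|v [v0 vd vm h]] := @gp_near eta (Num.min eta (w / 2)) eta0.
    by rewrite lt_min eta0 divr_gt0.
  move: vd; rewrite le_min => /andP[ve vw].
  have {}vw : v < w by lra.
  have := gp_conv_pos We t01 v0 vw wm.
  set u := t * v + _.
  have wu : (1 - t) * w <= u by rewrite lerDr; nra.
  have um : u <= m by rewrite /u; nra.
  have w1 : 0 <= (1 - t) * w by nra.
  have := gp_diff_bounds0 c0 cC w1 wu um.
  have -> : u - (1 - t) * w = t * v by rewrite /u; ring.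
  have tv : t * v <= eta by nra.
  have tv0 : 0 <= t * v by nra.
  have := ler_wpM2l (ltW (mulr_gt0 C0 pi0)) tv.
  have := mulr_ge0 (ltW (mulr_gt0 c0 pi0)) tv0.
  move=> h1 h2 /andP[h3 h4] h5.
  move: h; rewrite ler_norml => /andP[h6 h7].
  have t6 := ler_wpM2l (ltW t0) h6; have t7 := ler_wpM2l (ltW t0) h7.
  have te : t * eta <= eta by nra.
  by case: e1 h5 {We} => ->; lra.
move=> t x y /andP[t0 t1]; rewrite /= !in_itv/= => /andP[x0 xm] /andP[y0 ym].
have [->|tn0] := eqVneq t 0; first by rewrite !mul0r !add0r subr0 !mul1r.
have [->|tn1] := eqVneq t 1; first by rewrite subrr !mul0r !addr0 !mul1r.
have t01 : 0 < t < 1 by rewrite !lt_neqAle t0 t1 tn1 eq_sym tn0.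
have [xy|yx|->] := ltgtP x y; first exact: step.
  rewrite addrC [leRHS]addrC.
  have := @step (1 - t) y x; rewrite subKr; apply=> //.
  by case/andP: t01 => ? ?; apply/andP; split; lra.
by rewrite -!mulrDl subrKC !mul1r.
Qed.

Let gp_vmax : gp p m = 0.
Proof.
rewrite gp_action_density ?m_gt0 ?lexx// /action_end vmax_powR// subrr sqrtr0.
by rewrite set_itv1 Rintegral_set1.
Qed.

Let sqr4_itv (x : R) : 0 <= x < 2^-1 -> 0 <= 4 * x ^+ 2 < 1.
Proof. by move=> /andP[? ?]; apply/andP; split; nra. Qed.

(** The slopes of g_p are minus pi times means of W, so C < 2 bounds them by
    -2 pi, and W <= 1 or W >= 1 places them on the required side of -pi. *)
Let curve_fin_toric (e c C : R) : 0 < c -> C < 2 -> e = 1 \/ e = -1 ->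
    (forall x, 0 <= x < 2^-1 -> c <= W x <= C) ->
    (forall x, 0 <= x < 2^-1 -> e * W x <= e) ->
    (forall x y, 0 <= x -> x <= y -> y < 2^-1 -> e * W x <= e * W y) ->
  exists (a : R) (phi : R -> R), [/\ toric_profile a phi,
    convex_function (E := R^o) `[0, a] (fun x => e * phi x) &
    region_bounded_by (curve_fin p) = region_under a phi].
Proof.
move=> c0 C2 e1 cC eW We; have pi0 := @pi_gt0 R.
apply: (@action_curve_toric R m (gp p) e) => //.
- move=> v w v0 vw wm; have d0 : 0 < pi * (w - v) by rewrite mulr_gt0// subr_gt0.
  have /andP[h1 h2] := gp_diff_bounds0 c0 cC v0 (ltW vw) wm.
  have h3 : C * (pi * (w - v)) < 2 * (pi * (w - v)) by rewrite ltr_pM2r.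
  by have h4 := mulr_gt0 c0 d0; apply/andP; split; lra.
- move=> v w v0 vw wm; have d0 : 0 < pi * (w - v) by rewrite mulr_gt0// subr_gt0.
  case: e1 eW {We} => -> eW.
    have cC1 x : 0 <= x < 2^-1 -> c <= W x <= 1.
      move=> x1; have := eW x x1; rewrite !mul1r => ->; rewrite andbT.
      by case/andP: (cC x x1).
    by have /andP[_ h] := gp_diff_bounds0 c0 cC1 v0 (ltW vw) wm; lra.
  have cC1 x : 0 <= x < 2^-1 -> 1 <= W x <= C.
    move=> x1; have := eW x x1; rewrite !mulN1r lerN2 => -> /=.
    by case/andP: (cC x x1).
  by have /andP[h _] := gp_diff_bounds0 ltr01 cC1 v0 (ltW vw) wm; lra.
- exact: (gp_convex c0 cC e1 We).
Qed.

(** The weight decreases from sqrt (2 / p), which is less than 2, to 1. *)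
Lemma curve_fin_convex : p <= 2 -> exists (a : R) (phi : R -> R), [/\ toric_profile a phi,
    convex_function (E := R^o) `[0, a] (fun x => - phi x) &
    region_bounded_by (curve_fin p) = region_under a phi].
Proof.
move=> p2; have b1 : 1 <= b by rewrite /b ler_pdivlMr// mul1r.
have b2 : b <= 2 by rewrite /b ler_pdivrMr//; have := p_ge1; lra.
have W1 x : 0 <= x < 2^-1 -> 1 <= W x <= Num.sqrt b.
  move=> /sqr4_itv/(chord_slope_bounds b_gt0)[/(_ b1)/andP[h1 h2] _].
  by rewrite -{1}sqrtr1 !ler_wsqrtr.
have [||||||a [phi [tp cp rp]]] := @curve_fin_toric (-1) 1 (Num.sqrt b).
- by lra.
- have : Num.sqrt b < Num.sqrt (2 ^+ 2) by rewrite ltr_sqrt; lra.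
  by rewrite sqrtr_sqr ger0_norm.
- by right.
- exact: W1.
- by move=> x /W1/andP[h _]; rewrite mulN1r lerN2.
- move=> x y x0 xy y1; rewrite !mulN1r lerN2 ler_wsqrtr//.
  have xx : 0 <= 4 * x ^+ 2 by nra.
  have xy2 : 4 * x ^+ 2 <= 4 * y ^+ 2 by nra.
  have yy : 4 * y ^+ 2 < 1 by nra.
  by have [h _] := chord_slope_monotone b_gt0 xx xy2 yy; exact: h.
exists a, phi; split=> //; move: cp; congr (convex_function _ _).
by apply/funext => x; rewrite mulN1r.
Qed.

(** The weight increases from sqrt (2 / p) to 1. *)
Lemma curve_fin_concave : 2 <= p -> exists (a : R) (phi : R -> R), [/\ toric_profile a phi,
    convex_function (E := R^o) `[0, a] phi &
    region_bounded_by (curve_fin p) = region_under a phi].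
Proof.
move=> p2; have b1 : b <= 1 by rewrite /b ler_pdivrMr// mul1r.
have W1 x : 0 <= x < 2^-1 -> Num.sqrt b <= W x <= 1.
  move=> /sqr4_itv/(chord_slope_bounds b_gt0)[_ /(_ b1)/andP[h1 h2]].
  by rewrite -{1}sqrtr1 !ler_wsqrtr.
have [||||||a [phi [tp cp rp]]] := @curve_fin_toric 1 (Num.sqrt b) 1.
- by rewrite sqrtr_gt0.
- by lra.
- by left.
- exact: W1.
- by move=> x /W1/andP[_ h]; rewrite mul1r.
- move=> x y x0 xy y1; rewrite !mul1r ler_wsqrtr//.
  have xx : 0 <= 4 * x ^+ 2 by nra.
  have xy2 : 4 * x ^+ 2 <= 4 * y ^+ 2 by nra.
  have yy : 4 * y ^+ 2 < 1 by nra.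
  by have [_ h] := chord_slope_monotone b_gt0 xx xy2 yy; exact: h.
exists a, phi; split=> //; move: cp; congr (convex_function _ _).
by apply/funext => x; rewrite mul1r.
Qed.
End Comparison.

Theorem proposition8 (R : realType) (p : \bar R) :
  ((1 <= p <= 2)%E -> convex_toric_domain (toric_domain (Omega p))) /\
  ((2 <= p <= +oo)%E -> concave_toric_domain (toric_domain (Omega p))).
Proof.
case: p => [p| |]; split=> //.
- rewrite !lee_fin => /andP[p1 p2].
  have [a [phi [tp cp rp]]] := curve_fin_convex p1 p2.
  by exists a, phi; split=> //; rewrite -rp.
- rewrite lee_fin => /andP[p2 _].
  have [a [phi [tp cp rp]]] := curve_fin_concave (le_trans (ler1n R 2) p2) p2.
  by exists a, phi; split=> //; rewrite -rp.
- by case/andP.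
- move=> _; have [a [phi [tp cp rp]]] := curve_infty_concave R.
  by exists a, phi; split=> //; rewrite -rp.
Qed.
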